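(* Let $X$ be a continuous centered Gaussian process in $\mathbb{R}^d$ on $[0,T]$ with i.i.d. components, starting at the origin, whose covariance function $R$ is continuous and has finite 2D $\rho$-variation, $\rho\in[1,2)$. Then $\mathcal{W}^d_\rho$ is a dense subspace of $\mathcal{H}^d_1$, and the inclusion map $$i:\big(\mathcal{W}^d_\rho,\langle\cdot,\cdot\rangle_{\mathcal{W}^d_\rho}\big)\to\big(\mathcal{H}^d_1,\langle\cdot,\cdot\rangle_{\mathcal{H}^d_1}\big)$$ is an isometry.
   Context: $R(s,t)=\mathbb{E}[X^{(1)}_sX^{(1)}_t]$. Rectangular increment: $R\begin{pmatrix}a&b\\c&d\end{pmatrix}=R(a,c)+R(b,d)-R(a,d)-R(b,c)$; finite 2D $\rho$-variation means $\sup\sum_{i,j}\big|R\begin{pmatrix}u_i&u_{i+1}\\ v_j&v_{j+1}\end{pmatrix}\big|^\rho<\infty$ over grid partitions of $[0,T]^2$. The 2D Young–Stieltjes integral is $\int_{[0,T]^2}f\,\mathrm{d}R=\lim_{\|\pi\|\to0}\sum_{i,j}f(u_i,v_j)R\begin{pmatrix}u_i&u_{i+1}\\ v_j&v_{j+1}\end{pmatrix}$. $\mathcal{H}^d_1$ is the completion of the linear span of $\{\mathbf{1}_{[0,t)}(\cdot)e_u:t\in[0,T],u=1,\dots,d\}$ under $\langle\mathbf{1}_{[0,t)}e_u,\mathbf{1}_{[0,s)}e_v\rangle_{\mathcal{H}^d_1}=\delta_{uv}R(t,s)$. $\mathcal{C}^{p\text{-var}}_{pw}([0,T];E)$: functions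 $f$ for which there is a partition $\{t_i\}$ of $[0,T]$ such that $f$ is continuous with finite $p$-variation on each $(t_i,t_{i+1})$. Set $$\mathcal{W}^d_\rho:=\bigcup_{p<\frac{\rho}{\rho-1}}\mathcal{C}^{p\text{-var}}_{pw}([0,T];\mathbb{R}^d)$$ (with $\frac{\rho}{\rho-1}=\infty$ if $\rho=1$), equipped with $\langle f,g\rangle_{\mathcal{W}^d_\rho}:=\int_{[0,T]^2}\langle f_s,g_t\rangle_{\mathbb{R}^d}\,\mathrm{d}R(s,t)$. This is a semi-inner product; functions $f,g$ with $\langle f-g,f-g\rangle_{\mathcal{W}^d_\rho}=0$ are identified (so $\mathcal{W}^d_\rho$ denotes the quotient). The inclusion identifies $f\in\mathcal{W}^d_\rho$ with the limit in $\mathcal{H}^d_1$ of the step functions $f^\pi=\sum_if(r_i)\mathbf{1}_{[r_i,r_{i+1})}$, $\pi=\{r_i\}$, as the mesh $\|\pi\|\to0$. *)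

(* Defs.v *)
From HB Require Import structures.
From mathcomp Require Import all_boot all_order all_algebra.
From mathcomp Require Import all_classical all_reals all_analysis.
From mathcomp Require Export sesquilinear.

Set Implicit Arguments.
Unset Strict Implicit.
Unset Printing Implicit Defensive.

Import Order.TTheory GRing.Theory Num.Theory.
Import numFieldNormedType.Exports.

Local Open Scope classical_set_scope.
Local Open Scope ring_scope.

(* As in [itv_partition], a partition 0 = u_0 < ... < u_n = T of [0, T] is
   the list s = [:: u_1; ...; u_n]; hence u_i is (0 :: s)`_i and u_(i+1) is
   s`_i, for i < size s. Functions on [0, T] are represented by functions on
   the whole line; their values outside [0, T] are never used. *)

Section TwoDimensionalYoung.
Context {R : realType}.
Implicit Types (T rho : R) (s : seq R) (C F : R -> R -> R).

Definition mesh s : R :=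
  \big[Num.max/0]_(i < size s) (s`_i - (0 :: s)`_i).

(* The filter "||pi|| -> 0" on partitions pi of [0, T]. *)
Definition mesh0 T : set_system (seq R) :=
  filter_from [set e : R | 0 < e]
    (fun e => [set s | itv_partition 0 T s /\ mesh s < e]).

Definition rect_incr C (a b c d : R) : R :=
  C a c + C b d - C a d - C b c.

Definition variation2 rho C s (s' : seq R) : R :=
  \sum_(i < size s) \sum_(j < size s')
    `|rect_incr C (0 :: s)`_i s`_i (0 :: s')`_j s'`_j| `^ rho.

Definition finite_variation2 T rho C : Prop :=
  has_ubound [set x | exists s s', [/\ itv_partition 0 T s,
    itv_partition 0 T s' & x = variation2 rho C s s']].

Definition young_sum F C (pi : seq R * seq R) : R :=
  \sum_(i < size pi.1) \sum_(j < size pi.2)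
    F (0 :: pi.1)`_i (0 :: pi.2)`_j *
    rect_incr C (0 :: pi.1)`_i (pi.1)`_i (0 :: pi.2)`_j (pi.2)`_j.

(* The mesh of the grid (u_i) x (v_j) is the larger of the two meshes, so
   "mesh -> 0" is the product filter. *)
Definition young_integrable T F C : Prop :=
  cvg (young_sum F C @ filter_prod (mesh0 T) (mesh0 T)).

Definition young_integral T F C : R :=
  lim (young_sum F C @ filter_prod (mesh0 T) (mesh0 T)).

End TwoDimensionalYoung.

Section Wspace.
Context {R : realType} (d : nat).
Implicit Types (T rho p a b : R) (s : seq R) (f g : R -> 'rV[R]_d)
  (C : R -> R -> R).

Definition dotv (x y : 'rV[R]_d) : R := \sum_(u < d) x 0 u * y 0 u.
Definition enorm (x : 'rV[R]_d) : R := Num.sqrt (dotv x x).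

Definition pvariation p f (x : R) s : R :=
  \sum_(i < size s) enorm (f s`_i - f (x :: s)`_i) `^ p.

Definition finite_pvariation p a b f : Prop :=
  has_ubound [set v | exists x s, [/\ path <%R x s,
    (forall y, y \in x :: s -> y \in `]a, b[) & v = pvariation p f x s]].

Definition pw_continuous_pvar T p f : Prop :=
  exists2 s, itv_partition 0 T s & forall i, (i < size s)%N ->
    {within `](0 :: s)`_i, s`_i[, continuous f} /\
    finite_pvariation p (0 :: s)`_i s`_i f.

Definition conj_exponent rho : \bar R :=
  if rho == 1 then +oo%E else (rho / (rho - 1))%:E.

Definition Wfun T rho : set (R -> 'rV[R]_d) :=
  [set f | exists p, [/\ 1 <= p, (p%:E < conj_exponent rho)%E &
                         pw_continuous_pvar T p f]].

Definition W_integrand f g : R -> R -> R :=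
  fun r t => dotv (f r) (g t).

Definition W_ip T C f g : R := young_integral T (W_integrand f g) C.

Definition W_class T rho C f : set (R -> 'rV[R]_d) :=
  [set g | Wfun T rho g /\ W_ip T C (f - g) (f - g) = 0].

(* The quotient of [Wfun T rho] by the null functions of [W_ip T C]. *)
Definition Wspace T rho C : Type :=
  {A : set (R -> 'rV[R]_d) | exists2 f, Wfun T rho f & A = W_class T rho C f}.

Definition W_pi T rho C f (Wf : Wfun T rho f) : Wspace T rho C :=
  exist _ (W_class T rho C f) (ex_intro2 _ _ f Wf erefl).

(* 1_[0, t) e_u *)
Definition indic_vec (t : R) (u : 'I_d) : R -> 'rV[R]_d :=
  fun r => \1_(`[0, t[ : set R) r *: delta_mx 0 u.

Definition indic_span T : set (R -> 'rV[R]_d) :=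
  [set f | exists n (c t : 'I_n -> R) (u : 'I_n -> 'I_d),
    (forall k, t k \in `[0, T]) /\
    f = \sum_(k < n) c k *: indic_vec (t k) (u k)].

Definition step_fun f s : R -> 'rV[R]_d :=
  fun r => \sum_(i < size s)
    \1_(`[(0 :: s)`_i, s`_i[ : set R) r *: f (0 :: s)`_i.

End Wspace.

(* The Hilbert space H, with inner product ip, is the completion of the
   span of the 1_[0, t) e_u, with embedding J. Only the values of J on this
   span are meaningful. By linearity, J_ip determines ip on the span. *)
Record is_H1 (R : realType) (d : nat) (T : R) (C : R -> R -> R)
    (H : completeNormedModType R) (ip : {dot H for @idfun R})
    (J : (R -> 'rV[R]_d) -> H) : Prop := {
  ip_norm : forall x : H, ip x x = `|x| ^+ 2;
  J_linear : forall (a : R) (f g : R -> 'rV[R]_d),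
    indic_span T f -> indic_span T g -> J (a *: f + g) = a *: J f + J g;
  J_ip : forall (t s : R) (u v : 'I_d), t \in `[0, T] -> s \in `[0, T] ->
    ip (J (indic_vec t u)) (J (indic_vec s v)) = (u == v)%:R * C t s;
  J_dense : dense (J @` indic_span T) }.

Section GaussianProcess.
Context {disp : measure_display} {Omega : measurableType disp} {R : realType}
  {P : probability Omega R} (d : nat).
Implicit Types (X : R -> 'I_d -> {RV P >-> R}) (T : R).

(* The normal law with mean m and standard deviation sigma, which is the
   point mass at m if sigma = 0 ([normal_prob] is not meant for that case). *)
Definition gaussian_law (m sigma : R) (B : set R) : \bar R :=
  if sigma == 0 then \d_m B else normal_prob m sigma B.

Definition gaussian_process T X : Prop :=
  forall n (a t : 'I_n -> R) (u : 'I_n -> 'I_d),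
    (forall k, t k \in `[0, T]) ->
    exists m sigma : R, 0 <= sigma /\ forall B : set R, measurable B ->
      P [set w | B (\sum_(k < n) a k * X (t k) (u k) w)] =
      gaussian_law m sigma B.

Definition centered_process T X : Prop :=
  forall t u, t \in `[0, T] -> ('E_P[X t u] = 0)%E.

Definition continuous_process T X : Prop :=
  {ae P, forall w, forall u, {within `[0, T], continuous (fun t => X t u w)}}.

Definition starts_at_origin X : Prop :=
  {ae P, forall w, forall u, X 0 u w = 0}.

(* The sigma-algebra on paths generated by the evaluations at t in [0, T]. *)
Definition path_events T : set (set (R -> R)) :=
  <<s [set E | exists2 t, t \in `[0, T] & exists2 B : set R,
         measurable B & E = [set x | B (x t)]] >>.

Definition component X (u : 'I_d) (w : Omega) : R -> R := fun t => X t u w.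

Definition independent_components T X : Prop :=
  forall E : 'I_d -> set (R -> R), (forall u, path_events T (E u)) ->
    P (\bigcap_u (component X u @^-1` E u)) =
    (\prod_(u < d) P (component X u @^-1` E u))%E.

Definition identical_components T X : Prop :=
  forall (u v : 'I_d) (E : set (R -> R)), path_events T E ->
    P (component X u @^-1` E) = P (component X v @^-1` E).

Definition covariance_fun X (u : 'I_d) : R -> R -> R :=
  fun s t => fine ('E_P[X s u \* X t u])%E.

End GaussianProcess.

(* Main.v *)
Require Import Defs.
From HB Require Import structures.
From mathcomp Require Import all_boot all_order all_algebra.
From mathcomp Require Import all_classical all_reals all_analysis.
From mathcomp Require Import ring lra.

Set Implicit Arguments.
Unset Strict Implicit.
Unset Printing Implicit Defensive.

Import Order.TTheory GRing.Theory Num.Theory.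
Import numFieldNormedType.Exports.

Local Open Scope classical_set_scope.
Local Open Scope ring_scope.

(** Write x_t for the image J (1_[0,t) e_u) of an elementary step function. The
    covariance is the Gram kernel of this path, C s t = <x_s, x_t>, and distinct
    coordinates u are orthogonal. For a partition s of [0, T], J maps the step
    function of f along s to I(s) = sum_u sum_i f_u(s_i) (x_(s_(i+1)) - x_(s_i)),
    and the double Young sum of <f, g> along s and s' is the inner product
    <I_f(s), I_g(s')> ([young_sum_ip]). So everything follows once I_f(s)
    converges in H as the mesh goes to 0: the Young sums then converge to
    <lim I_f, lim I_g>, which gives the isometry, and with it linearity, the
    compatibility with the quotient and injectivity. Density holds because the
    limit for 1_[0,t) e_u is x_t itself ([embed_indic]), and the x_t span a dense
    subspace.

    The convergence is a two-dimensional Young estimate, obtained from the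
    one-dimensional one, [young_refine], used three times. Young's classical
    argument removes the points of a partition one at a time, choosing each time
    a point whose removal changes the sum little; it works for integrators with
    values in any seminormed space, and it can stop at a prescribed coarser
    partition instead of going down to [0, T].

    First, for a fixed partition s', the vector of the increments of C(t, .)
    along s' is a path t |-> G(t) in the space l^rho, and its rho-variation is
    bounded by the two-dimensional rho-variation of C. Young's bound in l^rho
    says that t |-> <x_t, I_f(s)> has rho-variation bounded uniformly in s
    ([gram_var]). Next, the scalar Young bound applied to |I_f(s)|^2 =
    sum_i f(s_i) <x_(s_(i+1)) - x_(s_i), I_f(s)> bounds |I_f(s)|
    ([gram_bounded]). Last, x is uniformly continuous, so the increments of
    <x_t, I_f(r)> over the intervals of a refinement of a fine partition s are
    uniformly small; trading rho for a slightly larger q turns this into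
    smallness of the q-variation, and Young's argument stopped at s shows that
    I_f(s) and I_f of a refinement are close ([gram_refine]). Two fine partitions
    are compared through their common refinement ([gram_cauchy]).

    The pieces of f glue to a function of finite p-variation on the whole of
    [0, T], jumps included ([fin_var_pieces]); the jumps are harmless because x
    is continuous. *)

(** * Sums over consecutive points *)

Section ConsecutiveSums.
Context {R : realType}.

(** The sum over the intervals of the partition x :: s, in recursive form: it
    splits along concatenations, which is what the removal of a point needs. *)
Fixpoint csum (V : nmodType) (phi : R -> R -> V) (x : R) (s : seq R) : V :=
  if s is y :: s' then phi x y + csum phi y s' else 0.

Lemma csumE (V : nmodType) (phi : R -> R -> V) x s :
  \sum_(i < size s) phi (x :: s)`_i s`_i = csum phi x s.
Proof.
elim: s x => [|y s IHs] x /=; first by rewrite big_ord0.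
by rewrite big_ord_recl /=; congr (_ + _); rewrite -IHs.
Qed.

Lemma csum_cat (V : nmodType) (phi : R -> R -> V) x s1 s2 :
  csum phi x (s1 ++ s2) = csum phi x s1 + csum phi (last x s1) s2.
Proof. by elim: s1 x => [|y s1 IHs] x /=; rewrite ?add0r// IHs addrA. Qed.

Lemma csum_morph (V W : nmodType) (g : V -> W) (phi : R -> R -> V) x s :
  g 0 = 0 -> {morph g : u v / u + v} ->
  g (csum phi x s) = csum (fun a b => g (phi a b)) x s.
Proof. by move=> g0 gD; elim: s x => //= y s IHs x; rewrite gD IHs. Qed.

Lemma csumD (V : nmodType) (phi psi : R -> R -> V) x s :
  csum (fun a b => phi a b + psi a b) x s = csum phi x s + csum psi x s.
Proof. by elim: s x => [|y s IHs] x /=; rewrite ?addr0// IHs addrACA. Qed.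

(** Here and below, a statement about all pairs of consecutive points of x :: s
    quantifies over the splittings of s at y; last x s1 is then the point just
    before y, also when s1 is empty. *)
Lemma eq_csum (V : nmodType) (phi psi : R -> R -> V) x s :
  (forall s1 y s2, s = s1 ++ y :: s2 ->
     phi (last x s1) y = psi (last x s1) y) ->
  csum phi x s = csum psi x s.
Proof.
elim: s x => //= y s IHs x h; congr (_ + _); first exact: (h [::] y s).
by apply: IHs => s1 z s2 e; apply: (h (y :: s1) z s2); rewrite e.
Qed.

Lemma ler_csum (phi psi : R -> R -> R) x s :
  (forall s1 y s2, s = s1 ++ y :: s2 ->
     phi (last x s1) y <= psi (last x s1) y) ->
  csum phi x s <= csum psi x s.
Proof.
elim: s x => //= y s IHs x h; apply: lerD; first exact: (h [::] y s).
by apply: IHs => s1 z s2 e; apply: (h (y :: s1) z s2); rewrite e.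
Qed.

Lemma part_consecutive (a b : R) s s1 y s2 :
  itv_partition a b s -> s = s1 ++ y :: s2 ->
  [/\ a <= last a s1, last a s1 < y & y <= b].
Proof.
move=> [sp /eqP sl] e; move: sp sl; rewrite e cat_path last_cat /=.
move=> /and3P[p1 lt p2] l2; split=> //.
  by apply: (@itv_partition_le _ _ a (last a s1) s1); split.
by apply: (@itv_partition_le _ _ y b s2); split=> //; apply/eqP.
Qed.

End ConsecutiveSums.

(** * Young's inequality for sums *)

Section Zeta.
Context {R : realType}.

(** The sum over j of the bounds (3 / j)^t on the change of a Riemann sum when
    one of j removable points is removed. *)
Definition zeta_sum (t : R) (n : nat) : R := \sum_(j < n) (3 / j.+1%:R) `^ t.

(** Cauchy condensation: the terms with index between 2^m and 2^(m+1) add up to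
    at most the m-th term of a geometric series of ratio 2^(1-t). *)
Lemma zeta_sum_bounded (t : R) : 1 < t ->
  exists2 K, 0 < K & forall n, zeta_sum t n <= K.
Proof.
move=> t1; pose r : R := 2 `^ (1 - t).
have r0 : 0 <= r by exact: powR_ge0.
have r1 : r < 1.
  rewrite /r -opprB powRN invf_lt1 ?powR_gt0//.
  apply: (@le_lt_trans _ _ (1 `^ (t - 1))); first by rewrite powR1.
  by apply: gt0_ltr_powR; rewrite ?nnegrE ?subr_gt0 ?ltr1n.
have step m : \sum_(2 ^ m <= j < 2 ^ m.+1) (j%:R : R) `^ (- t) <= r ^+ m.
  have -> : r ^+ m = \sum_(2 ^ m <= j < 2 ^ m.+1) ((2 ^ m)%:R : R) `^ (- t).
    have e : (2 ^ m)%:R = 2 `^ m%:R :> R by rewrite natrX powR_mulrn.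
    rewrite sumr_const_nat expnS mul2n -addnn addnK -[RHS]mulr_natl e.
    rewrite -powR_mulrn// /r -!powRrM -powRD ?pnatr_eq0 ?implybT//.
    by congr (_ `^ _); ring.
  apply: ler_sum_nat => j /andP[j1 j2]; rewrite !powRN lef_pV2 ?posrE; first last.
  - by rewrite powR_gt0// ltr0n expn_gt0.
  - by rewrite powR_gt0// ltr0n (leq_trans _ j1)// expn_gt0.
  by apply: ge0_ler_powR; rewrite ?nnegrE ?ler_nat//; lra.
have dy m : \sum_(1 <= j < 2 ^ m) (j%:R : R) `^ (- t) <= \sum_(i < m) r ^+ i.
  elim: m => [|m IH]; first by rewrite big_geq// big_ord0.
  rewrite big_ord_recr /= (@big_cat_nat _ _ _ (2 ^ m)) /= ?expn_gt0//.
    exact: lerD.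
  by rewrite leq_exp2l.
exists (3 `^ t * (1 - r)^-1).
  by rewrite mulr_gt0 ?powR_gt0// invr_gt0 subr_gt0.
move=> n.
have -> : zeta_sum t n = 3 `^ t * \sum_(1 <= j < n.+1) (j%:R : R) `^ (- t).
  rewrite /zeta_sum big_add1 /= big_mkord mulr_sumr; apply: eq_bigr => j _.
  by rewrite powRM// powRN -powR_inv1// -powRrM mulN1r powRN.
rewrite ler_pM2l ?powR_gt0//.
apply: (@le_trans _ _ (\sum_(1 <= j < 2 ^ n) (j%:R : R) `^ (- t))).
  rewrite [leRHS](@big_cat_nat _ _ _ n.+1) //=; last exact: ltn_expl.
  by rewrite lerDl sumr_ge0// => i _; exact: powR_ge0.
apply: (le_trans (dy n)).
have e : (1 - r) * \sum_(i < n) r ^+ i = 1 - r ^+ n.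
  by rewrite -[LHS]opprK -mulNr opprB -subrX1 opprB.
rewrite -(@ler_pM2l _ (1 - r)) ?subr_gt0// e divff; last by lra.
by rewrite lerBlDr lerDl exprn_ge0.
Qed.

End Zeta.

Lemma le_powR_inv {R : realType} (q x y : R) : 0 < q -> 0 <= x -> 0 <= y ->
  x `^ q <= y -> x <= y `^ q^-1.
Proof.
move=> q0 x0 y0 h.
rewrite -[x]powRr1// -(mulfV (lt0r_neq0 q0)) powRrM.
by apply: ge0_ler_powR; rewrite ?nnegrE ?invr_ge0 ?powR_ge0// ltW.
Qed.

Section Young.
Context {R : realType} {V : lmodType R}.

Definition riemann_sum (f : R -> R) (G : R -> V) (x : R) (s : seq R) : V :=
  csum (fun a b => f a *: (G b - G a)) x s.

(** The increments ending and starting at distinct points are distinct, so the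
    sum of w1 + w2 over the points outside keep is at most the total weight; it
    could not be if each of them carried more than c. The last point is
    kept, hence a removable point always has a successor z'. *)
Lemma pigeonhole (keep : pred R) (c : R) (w1 w2 : R -> R -> R) x s :
  (forall a b, 0 <= w1 a b) -> (forall a b, 0 <= w2 a b) -> 0 <= c ->
  keep (last x s) ->
  csum w1 x s + csum w2 x s < c * (count (predC keep) s)%:R ->
  exists s1 z z' s2, [/\ s = s1 ++ z :: z' :: s2, ~~ keep z &
    w1 (last x s1) z + w2 z z' <= c].
Proof.
move=> w10 w20 c0 kl lt; apply: contrapT => no.
have {no} no s1 z z' s2 : s = s1 ++ z :: z' :: s2 -> ~~ keep z ->
    c < w1 (last x s1) z + w2 z z'.
  move=> e kz; rewrite ltNge; apply/negP => le.
  by apply: no; exists s1, z, z', s2.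
suff : c * (count (predC keep) s)%:R <= csum w1 x s + csum w2 x s.
  by rewrite leNgt lt.
case: s kl {lt} no => [|z s] kl no; first by rewrite /= mulr0 addr0.
suff : c * (count (predC keep) (z :: s))%:R <= csum w1 x (z :: s) + csum w2 z s.
  by move=> /le_trans; apply; rewrite lerD2l /= lerDr.
elim: s x z kl no => [|z' s IHs] x z kl no.
  by move: kl => /= ->; rewrite /= !addr0 mulr0.
have {IHs} := IHs z z' kl _; set u := (count _ _); set v := (count _ _) => IH.
have {IH} : c * u%:R <= csum w1 z (z' :: s) + csum w2 z' s.
  by apply: IH => s1 y y' s2 e; apply: (no (z :: s1)); rewrite e.
have -> : v = (~~ keep z + u)%N by [].
rewrite natrD mulrDr [csum w1 x _]/= [csum w2 z _]/=.
have : c * (~~ keep z)%:R <= w1 x z + w2 z z'.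
  have [kz|kz] := boolP (keep z); first by rewrite mulr0 addr_ge0.
  by rewrite mulr1; apply: ltW; apply: (no [::] z z' s).
by rewrite /=; lra.
Qed.

Context (N : V -> R).
Hypothesis N_ge0 : forall v, 0 <= N v.
Hypothesis ND : forall u v, N (u + v) <= N u + N v.
Hypothesis NZ : forall (a : R) v, N (a *: v) = `|a| * N v.

(** Young's argument. Removing z between y and z' changes the Riemann sum by
    (f z - f y) *: (G z' - G z). After normalising both variations to 1, the
    pigeonhole principle gives one of the n+1 removable points for which this is
    at most (3 / (n+1))^(1/p + 1/q) A^(1/p) B^(1/q). The bound on the variation of
    G concerns the refinements of s0: this is where the smallness of G on the
    scale of s0 enters. *)
Lemma young_refine (f : R -> R) (G : R -> V) (p q A B a b : R)
    (keep : pred R) (s0 : seq R) :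
  0 < p -> 0 < q -> 0 < A -> 0 < B -> keep b ->
  (forall s, itv_partition a b s ->
     csum (fun x y => `|f y - f x| `^ p) a s <= A) ->
  (forall s, itv_partition a b s -> seq.filter keep s = s0 ->
     csum (fun x y => N (G y - G x) `^ q) a s <= B) ->
  forall s, itv_partition a b s -> seq.filter keep s = s0 ->
  N (riemann_sum f G a s - riemann_sum f G a s0) <=
    zeta_sum (p^-1 + q^-1) (count (predC keep) s) * (A `^ p^-1 * B `^ q^-1).
Proof.
move=> p0 q0 A0 B0 kb HA HB s.
move En : (count (predC keep) s) => n; elim: n s En => [|n IHn] s sn sab ss0.
  have -> : s0 = s.
    rewrite -ss0; apply/all_filterP; rewrite all_count -(count_predC keep s) sn.
    by rewrite addn0.
  by rewrite subrr -(scale0r 0) NZ normr0 mul0r /zeta_sum big_ord0 mul0r.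
pose w1 x y : R := A^-1 * `|f y - f x| `^ p.
pose w2 x y : R := B^-1 * N (G y - G x) `^ q.
have sab2 := sab; case: sab2 => sp /eqP sl.
(* the weights total at most 2; 3 makes the pigeonhole inequality strict *)
have [] := @pigeonhole keep (3 / n.+1%:R) w1 w2 a s.
- by move=> x y; rewrite mulr_ge0 ?powR_ge0 ?invr_ge0// ltW.
- by move=> x y; rewrite mulr_ge0 ?powR_ge0 ?invr_ge0// ltW.
- by rewrite divr_ge0.
- by rewrite sl.
- rewrite sn divfK ?pnatr_eq0//.
  have -> : csum w1 a s = A^-1 * csum (fun x y => `|f y - f x| `^ p) a s.
    by rewrite (@csum_morph _ _ _ ( *%R A^-1)) ?mulr0// => u v; rewrite mulrDr.
  have -> : csum w2 a s = B^-1 * csum (fun x y => N (G y - G x) `^ q) a s.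
    by rewrite (@csum_morph _ _ _ ( *%R B^-1)) ?mulr0// => u v; rewrite mulrDr.
  apply: (@le_lt_trans _ _ (1 + 1)); last by lra.
  by apply: lerD; rewrite ler_pdivrMl// mulr1; [exact: HA|exact: HB].
move=> s1 [z [z' [s2 [es kz le]]]].
pose s' := s1 ++ z' :: s2.
have s'ab : itv_partition a b s'.
  move: sp sl; rewrite es cat_path last_cat /= => /and4P[p1 lt1 lt2 p2] l2.
  split; last by rewrite last_cat /= l2.
  by rewrite cat_path /= p1 p2 (lt_trans lt1 lt2).
have s's0 : seq.filter keep s' = s0.
  by rewrite -ss0 es !filter_cat /= (negbTE kz).
have s'n : count (predC keep) s' = n.
  by move: sn; rewrite es !count_cat /= kz addnCA add1n => -[].
have {IHn} IH := IHn _ s'n s'ab s's0.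
set y := last a s1 in le.
have e : riemann_sum f G a s - riemann_sum f G a s' =
    (f z - f y) *: (G z' - G z).
  rewrite es /riemann_sum !csum_cat /= -/y; set r1 := csum _ a s1.
  set r2 := csum _ z' s2.
  have -> : G z' - G y = (G z' - G z) + (G z - G y) by rewrite addrA subrK.
  set u := G z' - G z; set v := G z - G y.
  rewrite [f y *: (u + v)]scalerDr scalerBl [r1 + _]addrC addrKA addrA.
  rewrite [X in _ - X]addrC addrKA [X in X - _]addrC [X in _ - X]addrC.
  by rewrite addrKA.
rewrite -(subrKA (riemann_sum f G a s')) e; apply: (le_trans (ND _ _)).
rewrite NZ /zeta_sum big_ord_recr /= mulrDl addrC; apply: lerD; first exact: IH.
set c : R := 3 / n.+1%:R in le *.
have c0 : 0 < c by rewrite divr_gt0.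
have fle : `|f z - f y| <= A `^ p^-1 * c `^ p^-1.
  rewrite -powRM ?(ltW A0) ?(ltW c0)//; apply: le_powR_inv => //.
    by rewrite mulr_ge0// ltW.
  rewrite -ler_pdivrMl//; apply: le_trans le.
  by rewrite lerDl mulr_ge0 ?powR_ge0 ?invr_ge0// ltW.
have Gle : N (G z' - G z) <= B `^ q^-1 * c `^ q^-1.
  rewrite -powRM ?(ltW B0) ?(ltW c0)//; apply: le_powR_inv => //.
    by rewrite mulr_ge0// ltW.
  rewrite -ler_pdivrMl//; apply: le_trans le.
  by rewrite lerDr mulr_ge0 ?powR_ge0 ?invr_ge0// ltW.
rewrite powRD; last by rewrite (gt_eqF c0) implybT.
apply: (le_trans (ler_pM _ _ fle Gle)) => //.
by rewrite mulrACA mulrC.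
Qed.

(** The case of [young_refine] in which every interior point is removed, so that
    f a *: (G b - G a) remains. *)
Lemma young_bound (f : R -> R) (G : R -> V) (p q A B a b K : R) :
  0 < p -> 0 < q -> 0 < A -> 0 < B -> a < b ->
  (forall n, zeta_sum (p^-1 + q^-1) n <= K) ->
  (forall s, itv_partition a b s ->
     csum (fun x y => `|f y - f x| `^ p) a s <= A) ->
  (forall s, itv_partition a b s ->
     csum (fun x y => N (G y - G x) `^ q) a s <= B) ->
  forall s, itv_partition a b s ->
  N (riemann_sum f G a s) <= (`|f a| + K * A `^ p^-1) * B `^ q^-1.
Proof.
move=> p0 q0 A0 B0 ab hK HA HB s sab.
have sb : [seq x <- s | x == b] = [:: b].
  case: sab => sp /eqP sl; apply: filter_pred1_uniq.
    by apply: lt_sorted_uniq; exact: path_sorted sp.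
  by have := mem_last a s; rewrite sl inE gt_eqF.
have e := @young_refine f G p q A B a b (fun x => x == b) [:: b] p0 q0 A0 B0
  (eqxx b) HA (fun s h _ => HB s h) s sab sb.
rewrite -(subrK (riemann_sum f G a [:: b]) (riemann_sum f G a s)).
apply: (le_trans (ND _ _)); rewrite mulrDl addrC; apply: lerD; last first.
  apply: (le_trans e); rewrite -mulrA ler_wpM2r ?mulr_ge0 ?powR_ge0//.
rewrite /riemann_sum /= addr0 NZ ler_wpM2l//; apply: le_powR_inv => //.
  exact: ltW.
by have := HB [:: b] (itv_partition1 ab); rewrite /= addr0.
Qed.

End Young.

(** * The l^q norm *)

Lemma powR_convex {R : realType} (q t x y : R) : 1 <= q -> 0 <= t -> t <= 1 ->
  0 <= x -> 0 <= y ->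
  (t * x + (1 - t) * y) `^ q <= t * x `^ q + (1 - t) * y `^ q.
Proof.
move=> q1 t0 t1 x0 y0.
have := @convex_powR _ _ q1 (Itv01 t0 t1) x y.
rewrite !inE /= !in_itv /= !andbT => /(_ x0 y0).
by [].
Qed.

Section LqNorm.
Context {R : realType} (m : nat) (q : R).
Hypothesis q_ge1 : 1 <= q.

Definition lq_norm (v : 'rV[R]_m) : R := (\sum_j `|v 0 j| `^ q) `^ q^-1.

Let q_gt0 : 0 < q. Proof. exact: lt_le_trans q_ge1. Qed.

Lemma lq_norm_ge0 v : 0 <= lq_norm v. Proof. exact: powR_ge0. Qed.

Lemma lq_sum_ge0 (v : 'rV[R]_m) : 0 <= \sum_j `|v 0 j| `^ q.
Proof. by apply: sumr_ge0 => j _; exact: powR_ge0. Qed.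

Lemma lq_norm_powR v : lq_norm v `^ q = \sum_j `|v 0 j| `^ q.
Proof. by rewrite -powRrM mulVf ?gt_eqF// powRr1// lq_sum_ge0. Qed.

Lemma lq_normZ (a : R) v : lq_norm (a *: v) = `|a| * lq_norm v.
Proof.
rewrite /lq_norm.
under eq_bigr do rewrite mxE normrM powRM//.
rewrite -mulr_sumr powRM ?powR_ge0 ?lq_sum_ge0//.
by rewrite -powRrM mulfV ?gt_eqF// powRr1.
Qed.

Lemma lq_norm_eq0 v : lq_norm v = 0 -> v = 0.
Proof.
move=> v0; apply/rowP => j; rewrite mxE; apply/eqP; rewrite -normr_eq0.
apply/eqP/(@powR_eq0_eq0 _ _ q)/eqP.
have qn0 : q != 0 by rewrite gt_eqF.
have := lq_norm_powR v; rewrite v0 powR0// => /esym/eqP.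
rewrite psumr_eq0 => [/allP/(_ j)|i _]; last exact: powR_ge0.
by rewrite mem_index_enum => /(_ isT).
Qed.

(** Minkowski's inequality: (u + v) / (a + b) is the convex combination of u / a
    and v / b with weights a / (a + b) and b / (a + b), where a and b are the
    norms of u and v, so by convexity of the power its q-th powers sum to at
    most 1. *)
Lemma lq_normD u v : lq_norm (u + v) <= lq_norm u + lq_norm v.
Proof.
have [/lq_norm_eq0 ->|u0] := eqVneq (lq_norm u) 0.
  by rewrite add0r lerDr lq_norm_ge0.
have [/lq_norm_eq0 ->|v0] := eqVneq (lq_norm v) 0.
  by rewrite addr0 lerDl lq_norm_ge0.
have {}u0 : 0 < lq_norm u by rewrite lt0r u0 lq_norm_ge0.
have {}v0 : 0 < lq_norm v by rewrite lt0r v0 lq_norm_ge0.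
have := lq_norm_powR u; have := lq_norm_powR v; rewrite [lq_norm (u + v)]/lq_norm.
move: (lq_norm u) (lq_norm v) u0 v0 => a b u0 v0 sv su.
have ab0 : 0 < a + b by exact: addr_gt0.
rewrite -[leRHS]powRr1 ?(ltW ab0)// -(mulfV (lt0r_neq0 q_gt0)) powRrM.
apply: ge0_ler_powR; rewrite ?nnegrE ?invr_ge0 ?(ltW q_gt0) ?powR_ge0 ?lq_sum_ge0//.
have le1 : a / (a + b) <= 1 by rewrite ler_pdivrMr// mul1r lerDl ltW.
have te' : 1 - a / (a + b) = b / (a + b) by field; rewrite gt_eqF.
have key j : `|(u + v) 0 j| `^ q <= (a + b) `^ q *
    (a / (a + b) * (`|u 0 j| `^ q / a `^ q) +
     b / (a + b) * (`|v 0 j| `^ q / b `^ q)).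
  have x0 : 0 <= `|u 0 j| / a by rewrite divr_ge0// ltW.
  have y0 : 0 <= `|v 0 j| / b by rewrite divr_ge0// ltW.
  have := powR_convex q_ge1 (divr_ge0 (ltW u0) (ltW ab0)) le1 x0 y0.
  rewrite te' !powRM ?invr_ge0 ?(ltW u0) ?(ltW v0)//.
  have ei c : 0 < c -> c^-1 `^ q = (c `^ q)^-1.
    by move=> c0; rewrite -[c^-1]powR_inv1 ?ltW// -powRrM mulN1r powRN.
  rewrite !ei// => h.
  apply: le_trans (ler_wpM2l (powR_ge0 _ _) h).
  rewrite -powRM ?(ltW ab0)//; last first.
    by rewrite addr_ge0// !mulr_ge0// ?invr_ge0 ltW.
  apply: ge0_ler_powR; rewrite ?nnegrE ?(ltW q_gt0)//.
    by rewrite mulr_ge0 ?addr_ge0// ?(ltW ab0) ?(ltW u0) ?(ltW v0)//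
      !mulr_ge0// ?invr_ge0 ltW.
  rewrite mxE; apply: (le_trans (ler_normD _ _)); rewrite le_eqVlt; apply/orP; left.
  by apply/eqP; field; rewrite !gt_eqF.
apply: (le_trans (ler_sum _ (fun j _ => key j))).
rewrite -mulr_sumr big_split /= -!mulr_sumr -!mulr_suml -su -sv.
rewrite !divff ?gt_eqF ?powR_gt0// !mulr1 -mulrDl divff ?gt_eqF// mulr1//.
Qed.

End LqNorm.

(** * Partitions and their refinements *)

Section Partitions.
Context {R : realType}.
Implicit Types (T a b : R) (s : seq R).

Lemma part_le_last a s z : path <%R a s -> z \in s -> z <= last a s.
Proof.
move=> + zs; case/splitPr: zs => s1 s2; rewrite cat_path last_cat /=.
move=> /and3P[_ _ p2]; apply: (@itv_partition_le _ _ z _ s2).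
by split.
Qed.

(** The common refinement is built so that s and s' are recovered by filtering,
    the form of refinement used in [young_refine]. *)
Lemma part_merge T s s' : itv_partition 0 T s -> itv_partition 0 T s' ->
  exists s'', [/\ itv_partition 0 T s'', [seq z <- s'' | z \in s] = s &
    [seq z <- s'' | z \in s'] = s'].
Proof.
move=> [sp /eqP sl] [sp' /eqP sl'].
pose s'' := sort <=%R (undup (s ++ s')).
have ss : sorted <%R s'' by rewrite sort_lt_sorted undup_uniq.
have memE z : (z \in s'') = (z \in s) || (z \in s').
  by rewrite mem_sort mem_undup mem_cat.
have filt r : path <%R 0 r -> {subset r <= s''} -> [seq z <- s'' | z \in r] = r.
  move=> pr sub; apply: lt_sorted_eq.
  - exact: lt_sorted_filter.
  - exact: path_sorted pr.
  - move=> z; rewrite mem_filter; case: (boolP (z \in r)) => //= zr.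
    by rewrite sub.
exists s''; split; last 2 first.
- by apply: filt => // z zs; rewrite memE zs.
- by apply: filt => // z zs; rewrite memE zs orbT.
have p : path <%R 0 s''.
  rewrite lt_path_sortedE ss andbT; apply/allP => z; rewrite memE.
  move: sp sp'; rewrite !lt_path_sortedE => /andP[/allP h _] /andP[/allP h' _].
  by move=> /orP[/h|/h'].
split=> //; rewrite eq_le; apply/andP; split.
  have := mem_last 0 s''; rewrite inE => /orP[/eqP ->|].
    by apply: (@itv_partition_le _ _ 0 T s); split=> //; apply/eqP.
  by rewrite memE => /orP[/(part_le_last sp)|/(part_le_last sp')]; rewrite ?sl ?sl'.
have := mem_last 0 s; rewrite sl inE => /orP[/eqP ->|Ts].
  by apply: (@itv_partition_le _ _ 0 _ s''); split.
by apply: part_le_last => //; rewrite memE Ts.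
Qed.

Lemma le_mesh s1 y s2 : y - last 0 s1 <= mesh (s1 ++ y :: s2).
Proof.
have lt : (size s1 < size (s1 ++ y :: s2))%N.
  by rewrite size_cat /= addnS ltnS leq_addr.
have := @le_bigmax _ _ _ (0 : R) (fun i : 'I_(size (s1 ++ y :: s2)) =>
  (s1 ++ y :: s2)`_i - (0 :: (s1 ++ y :: s2))`_i) (Ordinal lt).
rewrite /mesh /=; apply: le_trans; apply: lerB.
  by rewrite nth_cat ltnn subnn.
rewrite -cat_cons nth_cat /= ltnSn.
by rewrite -last_nth.
Qed.

Lemma part_bracket a s x : path <%R a s -> a <= x -> x < last a s ->
  exists s1 y s2, [/\ s = s1 ++ y :: s2, last a s1 <= x & x < y].
Proof.
elim: s a => [|z s IHs] a /=; first by move=> _ h1 h2; lra.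
move=> /andP[az pz] ax xl; have [xz|zx] := ltP x z.
  by exists [::], z, s.
have [s1 [y [s2 [-> h1 h2]]]] := IHs z pz zx xl.
by exists (z :: s1), y, s2.
Qed.

Lemma refine_bracket T s0 s s1 y s2 :
  itv_partition 0 T s0 -> itv_partition 0 T s -> {subset s0 <= s} ->
  s = s1 ++ y :: s2 ->
  exists r1 z r2, [/\ s0 = r1 ++ z :: r2, last 0 r1 <= last 0 s1 & y <= z].
Proof.
move=> [p0 /eqP l0] sT sub es.
have [x0 xy yT] := part_consecutive sT es.
have [|r1 [z [r2 [e0 h1 h2]]]] := part_bracket p0 x0.
  by rewrite l0; exact: lt_le_trans yT.
exists r1, z, r2; split=> //.
have : z \in s by apply: sub; rewrite e0 mem_cat inE eqxx orbT.
case: sT; rewrite es cat_path /= => /and3P[p1 _ p2] _.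
rewrite mem_cat inE => /or3P[/(part_le_last p1)|/eqP ->//|zs2].
  by move=> h; lra.
move: p2; rewrite lt_path_sortedE => /andP[/allP h _]; exact/ltW/h.
Qed.

Lemma refine_gap T s0 s s1 y s2 :
  itv_partition 0 T s0 -> itv_partition 0 T s -> {subset s0 <= s} ->
  s = s1 ++ y :: s2 -> y - last 0 s1 <= mesh s0.
Proof.
move=> s0T sT sub es.
have [r1 [z [r2 [-> h1 h2]]]] := refine_bracket s0T sT sub es.
by apply: le_trans (le_mesh _ _ _); exact: lerB.
Qed.

Lemma filter_subset (s0 s : seq R) : [seq z <- s | z \in s0] = s0 ->
  {subset s0 <= s}.
Proof. by move=> e z; rewrite -e mem_filter => /andP[]. Qed.

(** Passage between indices and splittings of s at an interval. *)
Lemma forall_consecutive (P : R -> R -> Prop) s :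
  (forall i, (i < size s)%N -> P (0 :: s)`_i s`_i) <->
  (forall s1 y s2, s = s1 ++ y :: s2 -> P (last 0 s1) y).
Proof.
split=> [h s1 y s2 e|h i lt].
  have lt : (size s1 < size s)%N by rewrite e size_cat /= addnS ltnS leq_addr.
  move: (h _ lt); rewrite e -cat_cons !nth_cat /= ltnSn ltnn subnn /=.
  by rewrite -last_nth.
have := h (take i s) s`_i (drop i.+1 s).
rewrite -drop_nth// cat_take_drop => /(_ erefl).
by rewrite (last_nth 0) size_take lt -[0 :: take i s]/(take i.+1 (0 :: s))
   nth_take.
Qed.

Lemma mesh_lt s e : 0 < e ->
  (forall s1 y s2, s = s1 ++ y :: s2 -> y - last 0 s1 < e) -> mesh s < e.
Proof.
move=> e0 h; rewrite /mesh; apply/bigmax_ltP; split=> // i _.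
exact: (proj2 (forall_consecutive (fun u v => v - u < e) s) h).
Qed.

End Partitions.

Section InnerProduct.
Context {R : realType} {H : completeNormedModType R} (ip : {dot H for @idfun R}).
Hypothesis ip_norm : forall x : H, ip x x = `|x| ^+ 2.

Lemma ipC x y : ip x y = ip y x.
Proof. by rewrite hermC /= expr0 mul1r. Qed.

Lemma ip_le x y : `|ip x y| <= `|x| * `|y|.
Proof.
have h (u v : H) : ip u v <= `|u| * `|v|.
  have : `|u + v| ^+ 2 <= (`|u| + `|v|) ^+ 2.
    by rewrite ler_pXn2r ?nnegrE ?addr_ge0 ?ler_normD.
  rewrite -ip_norm linearDl /= !linearDr /= !ip_norm (ipC v u) sqrrD; lra.
rewrite ler_norml h andbT lerNl.
by have := h (- x) y; rewrite normrN linearNl.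
Qed.

End InnerProduct.

(** * Riemann sums against a path in a Hilbert space *)

Section GramYoung.
Context {R : realType} {H : completeNormedModType R} (ip : {dot H for @idfun R}).
Hypothesis ip_norm : forall x : H, ip x x = `|x| ^+ 2.
Context (x : R -> H) (f : R -> R) (T p rho A V : R).
Hypotheses (T_gt0 : 0 < T) (p_ge1 : 1 <= p) (rho_ge1 : 1 <= rho).
Hypotheses (A_gt0 : 0 < A) (V_gt0 : 0 < V) (young_cond : 1 < p^-1 + rho^-1).
Hypothesis f_var : forall s : seq R, itv_partition 0 T s ->
  csum (fun a b => `|f b - f a| `^ p) 0 s <= A.
Hypothesis x_var : forall s s' : seq R, itv_partition 0 T s -> itv_partition 0 T s' ->
  csum (fun a b => csum (fun c d => `|ip (x b - x a) (x d - x c)| `^ rho) 0 s') 0 s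
    <= V.
Hypothesis x_unif : forall e : R, 0 < e -> exists2 h, 0 < h &
  forall a b, 0 <= a -> a < b -> b <= T -> b - a < h -> `|x b - x a| <= e.

Local Notation I := (riemann_sum f x 0).
Local Notation scal G := (G : R -> R^o).

Let p_gt0 : 0 < p. Proof. exact: lt_le_trans p_ge1. Qed.
Let rho_gt0 : 0 < rho. Proof. exact: lt_le_trans rho_ge1. Qed.

Lemma ip_riemann_sum s y :
  ip (I s) y = riemann_sum f (scal (fun t => ip (x t) y)) 0 s.
Proof.
rewrite /riemann_sum (@csum_morph _ _ _ (fun v => ip v y)) ?linear0l//.
  by apply: eq_csum => *; rewrite linearZl_LR /= linearBl.
by move=> u v; rewrite linearDl.
Qed.

(** The increments of t |-> <x_t, I s> along s' are the entries of a single
    Riemann sum of f against the path G of vectors indexed by s'. The l^rho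
    norm turns the rho-variation of G along any partition into a sum over a
    grid, which x_var bounds. *)
Lemma gram_var : exists2 B, 0 < B & forall s s',
  itv_partition 0 T s -> itv_partition 0 T s' ->
  csum (fun a b => `|ip (x b) (I s) - ip (x a) (I s)| `^ rho) 0 s' <= B.
Proof.
have [K K0 hK] := zeta_sum_bounded young_cond.
exists (((`|f 0| + K * A `^ p^-1) * V `^ rho^-1) `^ rho).
  by rewrite powR_gt0// mulr_gt0 ?powR_gt0// ltr_wpDl// mulr_gt0 ?powR_gt0.
move=> s s' sT s'T.
pose G t : 'rV[R]_(size s') := \row_j ip (x t) (x s'`_j - x (0 :: s')`_j).
have GE j : riemann_sum f G 0 s 0 j = ip (I s) (x s'`_j - x (0 :: s')`_j).
  rewrite ip_riemann_sum /riemann_sum.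
  rewrite (@csum_morph _ _ _ (fun v : 'rV[R]_(size s') => v 0 j)) ?mxE//.
    by apply: eq_csum => *; rewrite !mxE.
  by move=> u v; rewrite mxE.
have -> : csum (fun a b => `|ip (x b) (I s) - ip (x a) (I s)| `^ rho) 0 s' =
    lq_norm rho (riemann_sum f G 0 s) `^ rho.
  rewrite lq_norm_powR// -csumE; apply: eq_bigr => j _.
  by rewrite GE -linearBl (ipC ip).
apply: ge0_ler_powR; rewrite ?nnegrE ?lq_norm_ge0 ?(ltW rho_gt0)//.
  by rewrite mulr_ge0 ?powR_ge0// addr_ge0// mulr_ge0 ?powR_ge0// ltW.
apply: (@young_bound _ _ (lq_norm rho) _ _ _ f G p rho A V 0 T K) => //.
- by move=> u; exact: lq_norm_ge0.
- by move=> u v; exact: lq_normD.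
- by move=> a v; exact: lq_normZ.
- move=> r rT; apply: le_trans (x_var rT s'T); apply: ler_csum => r1 z r2 _.
  rewrite lq_norm_powR// -csumE le_eqVlt; apply/orP; left; apply/eqP.
  by apply: eq_bigr => j _; rewrite !mxE linearBl.
Qed.

(** |I s|^2 = <I s, I s> is a Riemann sum of f against t |-> <x_t, I s>, a scalar
    path whose variation [gram_var] bounds uniformly in s. *)
Lemma gram_bounded : exists2 M, 0 < M & forall s : seq R, itv_partition 0 T s ->
  `|I s| <= M.
Proof.
have [B B0 hB] := gram_var.
have [K K0 hK] := zeta_sum_bounded young_cond.
pose M2 := (`|f 0| + K * A `^ p^-1) * B `^ rho^-1.
have M20 : 0 < M2.
  by rewrite mulr_gt0 ?powR_gt0// ltr_wpDl// mulr_gt0 ?powR_gt0.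
exists (Num.sqrt M2) => [|s sT]; first by rewrite sqrtr_gt0.
rewrite -[leLHS]ger0_norm// -sqrtr_sqr ler_sqrt ?(ltW M20)//.
rewrite -ip_norm.
rewrite {1}ip_riemann_sum; apply: le_trans (ler_norm _) _.
apply: (@young_bound _ R^o (fun v => `|v|) _ _ _ f (fun t => ip (x t) (I s))
  p rho A B 0 T K) => //.
- exact: ler_normD.
- exact: normrM.
- by move=> r rT; exact: hB.
Qed.

(** 1/q is taken halfway between 1 - 1/p and 1/rho; it is positive as p >= 1. *)
Lemma exponent_room : exists2 q, rho < q & 1 < p^-1 + q^-1.
Proof.
have pi : p^-1 <= 1 by rewrite invf_le1.
exists (((1 - p^-1) + rho^-1) / 2)^-1.
  rewrite -[ltLHS]invrK ltf_pV2 ?posrE ?invr_gt0//; last first.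
    by rewrite divr_gt0// ltr_wpDl ?subr_ge0// invr_gt0.
  by move: young_cond; lra.
by rewrite invrK; move: young_cond; lra.
Qed.

(** |I s - I s0|^2 is the difference of the inner products of I s - I s0 with I s
    and with I s0. Each is the change, from s0 to s, of a Riemann sum against a
    scalar path t |-> <x_t, I r>, whose increments along refinements of s0 are at
    most e * M. Hence its q-variation is at most (e M)^(q - rho) times its
    rho-variation, and r = (q - rho) / q. *)
Lemma gram_refine : exists2 r, 0 < r & exists2 c, 0 < c &
  forall e s0 s, 0 < e -> itv_partition 0 T s0 -> itv_partition 0 T s ->
  [seq z <- s | z \in s0] = s0 ->
  (forall a b, 0 <= a -> a < b -> b <= T -> b - a <= mesh s0 ->
     `|x b - x a| <= e) ->
  `|I s - I s0| ^+ 2 <= c * e `^ r.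
Proof.
have [q rq q1] := exponent_room.
have q0 : 0 < q by exact: lt_trans rq.
have [B B0 hB] := gram_var.
have [M M0 hM] := gram_bounded.
have [K K0 hK] := zeta_sum_bounded q1.
exists ((q - rho) / q); first by rewrite divr_gt0// subr_gt0.
pose c := K * (A `^ p^-1 * (M `^ (q - rho) * B) `^ q^-1).
have c0 : 0 < c.
  by rewrite !mulr_gt0 ?powR_gt0// mulr_gt0 ?powR_gt0.
exists (c + c); first exact: addr_gt0.
move=> e s0 s e0 s0T sT s0s small.
have key r : itv_partition 0 T r ->
    `|ip (I s - I s0) (I r)| <= c * e `^ ((q - rho) / q).
  move=> rT; set G : R -> R^o := fun t => ip (x t) (I r).
  have -> : ip (I s - I s0) (I r) = riemann_sum f G 0 s - riemann_sum f G 0 s0.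
    by rewrite linearBl /= !ip_riemann_sum.
  pose B' := (e * M) `^ (q - rho) * B.
  have B'0 : 0 < B' by rewrite mulr_gt0 ?powR_gt0// mulr_gt0.
  have TS0 : T \in s0.
    case: s0T => _ /eqP lT.
    by have := mem_last 0 s0; rewrite lT inE gt_eqF.
  apply: le_trans (_ : K * (A `^ p^-1 * B' `^ q^-1) <= _).
    apply: (@le_trans _ _ (zeta_sum (p^-1 + q^-1)
      (count (predC [in s0]) s) * (A `^ p^-1 * B' `^ q^-1))); last first.
      by rewrite ler_wpM2r// mulr_ge0 ?powR_ge0.
    apply: (@young_refine _ R^o (fun v => `|v|) _ _ _ f G p q A B' 0 T [in s0] s0)
      => //.
    - exact: ler_normD.
    - exact: normrM.
    - move=> s' s'T s's0.
      apply: le_trans (_ : (e * M) `^ (q - rho) *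
        csum (fun a b => `|G b - G a| `^ rho) 0 s' <= _); last first.
        by rewrite ler_wpM2l ?powR_ge0//; exact: (hB r s').
      rewrite (@csum_morph _ _ _ ( *%R ((e * M) `^ (q - rho)))) ?mulr0//; last first.
        by move=> u v; rewrite mulrDr.
      apply: ler_csum => s1 y s2 es'.
      have [x0 xy yT] := part_consecutive s'T es'.
      have gap := refine_gap s0T s'T (filter_subset s's0) es'.
      have d_le : `|G y - G (last 0 s1)| <= e * M.
        rewrite /G -linearBl /=; apply: (le_trans (ip_le ip_norm _ _)).
        by apply: ler_pM => //; [exact: small|exact: hM].
      have -> : q = (q - rho) + rho by rewrite subrK.
      rewrite addrK powRD; last by rewrite subrK (gt_eqF q0).
      rewrite ler_wpM2r ?powR_ge0//; apply: ge0_ler_powR => //.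
        by rewrite subr_ge0 ltW.
      by rewrite nnegrE mulr_ge0// ltW.
  rewrite /c -!mulrA ler_pM2l// ler_pM2l ?powR_gt0//.
  rewrite /B' !powRM ?powR_ge0 ?(ltW e0) ?(ltW M0) ?(ltW B0) ?mulr_ge0//;
    rewrite ?powR_ge0 ?(ltW B0)//.
  by rewrite powRrM -mulrA mulrC.
rewrite -ip_norm linearBr /=.
apply: (le_trans (ler_norm _)); apply: (le_trans (ler_normB _ _)).
by rewrite mulrDl; apply: lerD; exact: key.
Qed.

Lemma gram_cauchy (e : R) : 0 < e -> exists2 h, 0 < h &
  forall s s' : seq R, itv_partition 0 T s -> itv_partition 0 T s' ->
  mesh s < h -> mesh s' < h -> `|I s - I s'| <= e.
Proof.
move=> e0; have [r r0 [c c0 hr]] := gram_refine.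
pose d := ((e / 2) ^+ 2 / c) `^ r^-1.
have e20 : 0 < (e / 2) ^+ 2 / c by rewrite divr_gt0// exprn_gt0// divr_gt0.
have d0 : 0 < d by rewrite powR_gt0.
have dr : c * d `^ r = (e / 2) ^+ 2.
  by rewrite /d -powRrM mulVf ?gt_eqF// powRr1 ?ltW// mulrC divfK ?gt_eqF.
have [h h0 hx] := x_unif d0; exists h => // s s' sT s'T ms ms'.
have [s'' [s''T fs fs']] := part_merge sT s'T.
have half s0 : itv_partition 0 T s0 -> mesh s0 < h ->
    [seq z <- s'' | z \in s0] = s0 -> `|I s'' - I s0| <= e / 2.
  move=> s0T ms0 fs0.
  have e2 : 0 <= e / 2 by rewrite divr_ge0// ltW.
  rewrite -(@ler_pXn2r _ 2) ?nnegrE// -dr.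
  apply: hr => // a b a0 ab bT gap; apply: hx => //.
  exact: le_lt_trans ms0.
have -> : I s - I s' = (I s'' - I s') - (I s'' - I s).
  by rewrite opprB [RHS]addrC subrKA.
apply: (le_trans (ler_normB _ _)); rewrite [leRHS]splitr.
by apply: lerD; exact: half.
Qed.

End GramYoung.

(** * Finite variation on a set *)

Section Variation.
Context {R : realType}.
Implicit Types (p : R) (D : set R) (w : R -> R -> R) (g : R -> R).

(** The weight w a b is the size of an increment from a to b. The points of the
    path range over D, without prescribed end points, which makes the notion
    monotone in D and local. *)
Definition fin_var p D w : Prop := exists2 A, 0 <= A &
  forall x s, path <%R x s -> (forall y, y \in x :: s -> D y) ->
  csum (fun a b => w a b `^ p) x s <= A.

Lemma fin_varW p D D' w : D' `<=` D -> fin_var p D w -> fin_var p D' w.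
Proof.
move=> sub [A A0 h]; exists A => // x s xs sD; apply: h => // y /sD.
exact: sub.
Qed.

Lemma fin_var_le p D w w' : 0 <= p -> (forall a b, 0 <= w a b <= w' a b) ->
  fin_var p D w' -> fin_var p D w.
Proof.
move=> p0 ww [A A0 h]; exists A => // x s xs sD.
apply: le_trans (h x s xs sD); apply: ler_csum => s1 y s2 _.
have /andP[w0 ww'] := ww (last x s1) y.
by apply: ge0_ler_powR; rewrite ?nnegrE// (le_trans w0).
Qed.

Lemma powRD_le p (x y : R) : 0 <= p -> 0 <= x -> 0 <= y ->
  (x + y) `^ p <= 2 `^ p * (x `^ p + y `^ p).
Proof.
move=> p0 x0 y0.
have h (u v : R) : 0 <= u -> u <= v -> (u + v) `^ p <= 2 `^ p * (u `^ p + v `^ p).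
  move=> u0 uv; have v0 := le_trans u0 uv.
  apply: (@le_trans _ _ ((2 * v) `^ p)); last first.
    by rewrite powRM// ler_wpM2l ?powR_ge0// lerDr powR_ge0.
  by apply: ge0_ler_powR; rewrite ?nnegrE ?addr_ge0 ?mulr_ge0//; lra.
have [xy|/ltW yx] := leP x y; first exact: h.
by rewrite addrC [X in _ * X]addrC; exact: h.
Qed.

Lemma fin_varD p D w w1 w2 : 0 <= p ->
  (forall a b, 0 <= w1 a b) -> (forall a b, 0 <= w2 a b) ->
  (forall a b, 0 <= w a b <= w1 a b + w2 a b) ->
  fin_var p D w1 -> fin_var p D w2 -> fin_var p D w.
Proof.
move=> p0 w10 w20 ww [A1 A10 h1] [A2 A20 h2]; exists (2 `^ p * (A1 + A2)).
  by rewrite mulr_ge0 ?powR_ge0 ?addr_ge0.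
move=> x s xs sD.
apply: (@le_trans _ _ (2 `^ p * (csum (fun a b => w1 a b `^ p) x s +
    csum (fun a b => w2 a b `^ p) x s))); last first.
  by rewrite ler_wpM2l ?powR_ge0// lerD ?h1 ?h2.
rewrite -csumD (@csum_morph _ _ _ ( *%R (2 `^ p))) ?mulr0//; last first.
  by move=> u v; rewrite mulrDr.
apply: ler_csum => s1 y s2 _; have /andP[w0 ww'] := ww (last x s1) y.
apply: le_trans (powRD_le _ _ _) => //.
by apply: ge0_ler_powR; rewrite ?nnegrE ?addr_ge0.
Qed.

Lemma fin_varZ p D w (c : R) : 0 <= c -> (forall a b, 0 <= w a b) ->
  fin_var p D w -> fin_var p D (fun a b => c * w a b).
Proof.
move=> c0 w0 [A A0 h]; exists (c `^ p * A); first by rewrite mulr_ge0 ?powR_ge0.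
move=> x s xs sD; apply: le_trans (ler_wpM2l (powR_ge0 c p) (h x s xs sD)).
rewrite (@csum_morph _ _ _ ( *%R (c `^ p))) ?mulr0//; last first.
  by move=> u v; rewrite mulrDr.
by apply: ler_csum => s1 y s2 _; rewrite powRM.
Qed.

Lemma fin_var_bounded p D w : 0 < p -> (forall a b, 0 <= w a b) ->
  fin_var p D w -> exists2 M, 0 <= M & forall x y, D x -> D y -> x < y ->
  w x y <= M.
Proof.
move=> p0 w0 [A A0 h]; exists (A `^ p^-1); first exact: powR_ge0.
move=> x y Dx Dy xy; apply: le_powR_inv => //.
have := h x [:: y]; rewrite /= xy addr0 => /(_ isT); apply => z.
by rewrite !inE => /orP[/eqP ->|/eqP ->].
Qed.

(** The increments are bounded by some M, so w^p' <= M^(p' - p) w^p. *)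
Lemma fin_var_exp p p' D w : 0 < p -> p <= p' -> (forall a b, 0 <= w a b) ->
  fin_var p D w -> fin_var p' D w.
Proof.
move=> p0 pp' w0 wD; have [M M0 hM] := fin_var_bounded p0 w0 wD.
have [A A0 h] := wD; exists (M `^ (p' - p) * A).
  by rewrite mulr_ge0 ?powR_ge0.
move=> x s xs sD; apply: le_trans (ler_wpM2l (powR_ge0 M _) (h x s xs sD)).
rewrite (@csum_morph _ _ _ ( *%R (M `^ (p' - p)))) ?mulr0//; last first.
  by move=> u v; rewrite mulrDr.
apply: ler_csum => s1 y s2 es.
have wM : w (last x s1) y <= M.
  move: sD xs; rewrite es => sD; rewrite cat_path => /and3P[_ lt _].
  apply: hM => //; apply: sD.
    by rewrite -cat_cons mem_cat mem_last.
  by rewrite -cat_cons mem_cat mem_head orbT.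
have -> : p' = (p' - p) + p by rewrite subrK.
rewrite addrK powRD; last by rewrite subrK (gt_eqF (lt_le_trans p0 pp')).
rewrite ler_wpM2r ?powR_ge0//; apply: ge0_ler_powR; rewrite ?nnegrE//.
by rewrite subr_ge0.
Qed.

(** A path in the union crosses from D1 to D2 at most once, and the increment
    that straddles the crossing is controlled because g is bounded on each
    piece. *)
Lemma fin_var_glue p D1 D2 g : 0 < p ->
  (forall x y, D1 x -> D2 y -> x < y) ->
  fin_var p D1 (fun a b => `|g b - g a|) ->
  fin_var p D2 (fun a b => `|g b - g a|) ->
  fin_var p (D1 `|` D2) (fun a b => `|g b - g a|).
Proof.
move=> p0 D12 v1 v2.
have bnd D : fin_var p D (fun a b => `|g b - g a|) ->
    exists2 M, 0 <= M & forall x, D x -> `|g x| <= M.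
  move=> v; have [M M0 hM] := fin_var_bounded p0 (fun a b => normr_ge0 _) v.
  have [[y Dy]|no] := pselect (D !=set0); last first.
    by exists 0 => // x Dx; exfalso; apply: no; exists x.
  exists (`|g y| + M); first by rewrite addr_ge0.
  move=> x Dx; rewrite -[g x](subrKC (g y)).
  apply: (le_trans (ler_normD _ _)); rewrite lerD2l.
  have [xy|yx|->] := ltgtP x y; last by rewrite subrr normr0.
    by rewrite distrC; exact: hM.
  exact: hM.
have [M1 M10 b1] := bnd _ v1; have [M2 M20 b2] := bnd _ v2.
have [A1 A10 h1] := v1; have [A2 A20 h2] := v2.
pose J := (M1 + M2) `^ p; have J0 : 0 <= J by exact: powR_ge0.
exists (A1 + (J + A2)); first by rewrite !addr_ge0.
set phi := fun a b => _.
have split s : forall x, D1 x -> path <%R x s ->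
    (forall y, y \in s -> (D1 `|` D2) y) ->
    exists s1 s2, [/\ s = s1 ++ s2, (forall y, y \in x :: s1 -> D1 y) &
      (forall y, y \in s2 -> D2 y)].
  elim: s => [|z s IHs] x Dx /=.
    by exists [::], [::]; split=> // y; rewrite inE => /eqP ->.
  move=> /andP[xz zs] sD; have [Dz|nDz] := pselect (D1 z).
    have [|s1 [s2 [-> hs1 hs2]]] := IHs z Dz zs.
      by move=> y ys; apply: sD; rewrite inE ys orbT.
    exists (z :: s1), s2; split=> // y; rewrite inE => /orP[/eqP ->//|].
    exact: hs1.
  have D2z : D2 z by case: (sD z (mem_head _ _)).
  exists [::], (z :: s); split=> //; first by move=> y; rewrite inE => /eqP ->.
  move=> y; rewrite inE => /orP[/eqP ->//|ys].
  case: (sD y); rewrite ?inE ?ys ?orbT// => D1y.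
  have := D12 _ _ D1y D2z; move: zs; rewrite lt_path_sortedE => /andP[/allP h _].
  by have := h y ys; lra.
move=> x s xs sD.
have [D1x|nD1x] := pselect (D1 x); last first.
  have D2x : D2 x by case: (sD x (mem_head _ _)).
  apply: le_trans (_ : A2 <= _); last by rewrite addrA lerDr addr_ge0.
  apply: h2 => // y; rewrite inE => /orP[/eqP ->//|ys].
  case: (sD y); rewrite ?inE ?ys ?orbT// => D1y.
  have := D12 _ _ D1y D2x; move: xs; rewrite lt_path_sortedE => /andP[/allP h _].
  by have := h y ys; lra.
have [|s1 [s2 [es hs1 hs2]]] := split s x D1x xs.
  by move=> y ys; apply: sD; rewrite inE ys orbT.
move: xs; rewrite es cat_path csum_cat => /andP[xs1 xs2].
apply: lerD; first exact: h1.
case: s2 {es} hs2 xs2 => [|z s2] hs2 /=; first by rewrite addr_ge0.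
move=> /andP[_ zs2]; apply: lerD; last exact: h2.
apply: ge0_ler_powR; rewrite ?nnegrE ?addr_ge0 ?(ltW p0)//.
apply: (le_trans (ler_normB _ _)); rewrite addrC; apply: lerD.
  by apply: b1; apply: hs1; exact: mem_last.
by apply: b2; apply: hs2; exact: mem_head.
Qed.

Lemma fin_var1 p w (a : R) : fin_var p [set a] w.
Proof.
exists 0 => // x [|y s] //= /andP[xy _] h.
have xa : x = a by apply: h; rewrite mem_head.
have ya : y = a by apply: h; rewrite !inE eqxx orbT.
by move: xy; rewrite xa ya ltxx.
Qed.

(** Each division point is glued as a piece of its own: nothing is known there
    about the values of g. *)
Lemma fin_var_pieces p g (a : R) s : 0 < p -> path <%R a s ->
  (forall s1 y s2, s = s1 ++ y :: s2 ->
    fin_var p `](last a s1), y[ (fun u v => `|g v - g u|)) ->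
  fin_var p `[a, last a s] (fun u v => `|g v - g u|).
Proof.
move=> p0; elim: s a => [|y s IHs] a /=.
  move=> _ _; apply: fin_varW (fin_var1 _ _ a) => x /=.
  by rewrite in_itv /= => /andP[h1 h2]; apply/eqP; rewrite eq_le h1 h2.
move=> /andP[ay ys] h.
have : fin_var p ([set a] `|` (`]a, y[ `|` `[y, last y s]))
    (fun u v => `|g v - g u|).
  apply: fin_var_glue => //; last apply: fin_var_glue => //.
  - move=> _ z -> [|]; rewrite /= in_itv /= => /andP[] //.
    by move=> yz _; exact: lt_le_trans yz.
  - exact: fin_var1.
  - move=> u v; rewrite /= !in_itv /= => /andP[_ uy] /andP[yv _].
    exact: lt_le_trans yv.
  - exact: (h [::] y s).
  - by apply: IHs => // s1 z s2 e; apply: (h (y :: s1) z s2); rewrite e.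
apply: fin_varW => x; rewrite /= in_itv /= => /andP[ax xl].
rewrite !in_itv /=; have [yx|xy] := leP y x; first by right; right; apply/andP.
have [->|xa] := eqVneq x a; first by left.
by right; left; rewrite lt_neqAle eq_sym xa ax.
Qed.

End Variation.

(** * The space of integrands *)

Section Wfunctions.
Context {R : realType} (d : nat).
Implicit Types (T rho p a b : R) (f g : R -> 'rV[R]_d) (s : seq R).

Local Notation incr f := (fun u v : R => enorm (f v - f u)).

Lemma enorm_lq (v : 'rV[R]_d) : enorm v = lq_norm 2 v.
Proof.
rewrite /enorm /lq_norm -powR12_sqrt; last first.
  by apply: sumr_ge0 => j _; rewrite -expr2 sqr_ge0.
congr (_ `^ _); apply: eq_bigr => j _.
by rewrite powR_mulrn// -normrX ger0_norm ?sqr_ge0// expr2.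
Qed.

Lemma enorm_ge0 (v : 'rV[R]_d) : 0 <= enorm v.
Proof. exact: sqrtr_ge0. Qed.

Lemma enorm_coord (v : 'rV[R]_d) u : `|v 0 u| <= enorm v.
Proof.
rewrite /enorm -sqrtr_sqr ler_wsqrtr// /dotv (bigD1 u) //= expr2 lerDl.
by apply: sumr_ge0 => j _; rewrite -expr2 sqr_ge0.
Qed.

Lemma finite_pvariationP p a b f :
  finite_pvariation p a b f <-> fin_var p `]a, b[ (incr f).
Proof.
split=> [[A hA]|[A A0 h]].
  exists `|A| => // x s xs sD; apply: le_trans (ler_norm A); apply: hA.
  by exists x, s; split=> //; rewrite -csumE.
exists A => _ [x [s [xs sD ->]]]; rewrite /pvariation.
by rewrite (csumE (fun u v => enorm (f v - f u) `^ p)); exact: h.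
Qed.

Lemma pw_continuous_pvarP T p f : pw_continuous_pvar T p f <->
  exists2 s, itv_partition 0 T s & forall s1 y s2, s = s1 ++ y :: s2 ->
    {within `](last 0 s1), y[, continuous f} /\
    fin_var p `](last 0 s1), y[ (incr f).
Proof.
have key s := forall_consecutive (fun a b => {within `]a, b[, continuous f} /\
  finite_pvariation p a b f) s.
split=> -[s sT]; [move=> /key h|move=> h]; exists s => //.
  by move=> s1 y s2 /h[hc /finite_pvariationP hv].
by apply/key => s1 y s2 /h[hc /finite_pvariationP hv].
Qed.

(** The condition p < rho / (rho - 1) is 1/p + 1/rho > 1, and the pieces of f
    glue to finite p-variation on [0, T] whatever the jumps. *)
Lemma Wfun_young T rho f u : 0 < T -> 1 <= rho -> Wfun T rho f ->
  exists p, [/\ 1 <= p, 1 < p^-1 + rho^-1 &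
    fin_var p `[0, T] (fun a b => `|f b 0 u - f a 0 u|)].
Proof.
move=> T0 rho1 [p [p1 prho /pw_continuous_pvarP[s [sp /eqP sT] hs]]].
have p0 : 0 < p := lt_le_trans ltr01 p1.
exists p; split=> //.
  move: prho; rewrite /conj_exponent; case: eqVneq => [->|rhon1] h.
    by rewrite invr1 ltrDr invr_gt0.
  have rho2 : 1 < rho by rewrite lt_neqAle eq_sym rhon1.
  move: h; rewrite lte_fin => h.
  have : (rho / (rho - 1))^-1 < p^-1.
    by rewrite ltf_pV2 ?posrE// divr_gt0 ?subr_gt0// (lt_trans _ rho2).
  rewrite invf_div mulrBl divff ?mul1r; last by rewrite gt_eqF// (lt_trans _ rho2).
  by lra.
rewrite -sT; apply: (fin_var_pieces (g := fun t => f t 0 u)) => // s1 y s2 es.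
have [_] := hs s1 y s2 es; apply: fin_var_le; first exact: ltW.
move=> a b; rewrite normr_ge0 /=; have := enorm_coord (f b - f a) u.
by rewrite !mxE.
Qed.

(** Two integrands are compared on the common refinement of their partitions,
    with the larger of their exponents. *)
Lemma Wfun_lin T rho (c : R) f g :
  Wfun T rho f -> Wfun T rho g -> Wfun T rho (c *: f + g).
Proof.
move=> [p [p1 prho /pw_continuous_pvarP[s sT hs]]].
move=> [p' [p'1 p'rho /pw_continuous_pvarP[s' s'T hs']]].
have p0 : 0 < p := lt_le_trans ltr01 p1.
have p'0 : 0 < p' := lt_le_trans ltr01 p'1.
exists (Num.max p p'); split.
- by rewrite le_max p1.
- by rewrite /Num.max; case: ifP.
apply/pw_continuous_pvarP.
have [s'' [s''T /filter_subset sub /filter_subset sub']] := part_merge sT s'T.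
exists s'' => // s1 y s2 es.
have [r1 [z [r2 [er h1 h2]]]] := refine_bracket sT s''T sub es.
have [r1' [z' [r2' [er' h1' h2']]]] := refine_bracket s'T s''T sub' es.
have inc : `](last 0 s1), y[%classic `<=` `](last 0 r1), z[.
  move=> t /=; rewrite !in_itv /= => /andP[t1 t2].
  by rewrite (le_lt_trans h1)//= (lt_le_trans t2).
have inc' : `](last 0 s1), y[%classic `<=` `](last 0 r1'), z'[.
  move=> t /=; rewrite !in_itv /= => /andP[t1 t2].
  by rewrite (le_lt_trans h1')//= (lt_le_trans t2).
have [fc fv] := hs _ _ _ er; have [gc gv] := hs' _ _ _ er'.
have q0 : 0 < Num.max p p' by rewrite lt_max p0.
split.
  apply: within_continuousD; last exact: continuous_subspaceW gc.
  apply: (@within_continuous_comp _ _ _ _ f ( *:%R c)).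
    by move=> v _; exact: scaler_continuous.
  exact: continuous_subspaceW fc.
apply: (@fin_varD _ _ _ _ (fun u v => `|c| * enorm (f v - f u)) (incr g)).
- exact: ltW.
- by move=> a b; rewrite mulr_ge0 ?enorm_ge0.
- by move=> a b; exact: enorm_ge0.
- move=> a b; rewrite enorm_ge0 /= !enorm_lq.
  have -> : (c *: f + g) b - (c *: f + g) a = c *: (f b - f a) + (g b - g a).
    by rewrite scalerBr opprD addrACA.
  by apply: (le_trans (lq_normD _ _ _)); rewrite ?lq_normZ//; lra.
- apply: fin_varZ => [//|a b|]; first exact: enorm_ge0.
  apply: fin_var_exp (fin_varW inc fv) => //; first by rewrite le_max lexx.
  by move=> a b; exact: enorm_ge0.
- apply: fin_var_exp (fin_varW inc' gv) => //; first by rewrite le_max lexx orbT.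
  by move=> a b; exact: enorm_ge0.
Qed.

Lemma Wfun_piecewise_const T rho f s : 1 <= rho -> rho < 2 ->
  itv_partition 0 T s ->
  (forall i, (i < size s)%N -> exists c, forall t,
     t \in `](0 :: s)`_i, s`_i[ -> f t = c) -> Wfun T rho f.
Proof.
move=> rho1 rho2 sT h; exists 1; split=> //.
  rewrite /conj_exponent; case: eqVneq => [_|rhon1]; first exact: ltry.
  have rho3 : 1 < rho by rewrite lt_neqAle eq_sym rhon1.
  by rewrite lte_fin ltr_pdivlMr ?subr_gt0// mul1r; lra.
exists s => // i si; have [c hc] := h i si; split.
  apply: (@subspace_eq_continuous _ _ _ (fun=> c) f).
    by move=> t; rewrite inE => /hc /esym.
  exact: cst_continuous.
exists 0 => _ [x [r [xr rD ->]]]; rewrite /pvariation big1// => j _.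
rewrite !hc.
- rewrite subrr /enorm /dotv big1 ?sqrtr0 ?powR0 ?oner_eq0// => u _.
  by rewrite mxE mul0r.
- by apply: rD; apply: mem_nth; rewrite /= ltnS ltnW.
- by apply: rD; rewrite inE mem_nth ?orbT.
Qed.

Lemma Wfun0 T rho : 0 < T -> 1 <= rho -> rho < 2 ->
  Wfun T rho (0 : R -> 'rV[R]_d).
Proof.
move=> T0 rho1 rho2; apply: (Wfun_piecewise_const (s := [:: T])) => //.
  exact: itv_partition1.
by move=> i _; exists 0.
Qed.

Lemma Wfun_indic T rho t (u : 'I_d) : 0 < T -> 1 <= rho -> rho < 2 ->
  t \in `[0, T] -> Wfun T rho (indic_vec t u).
Proof.
move=> T0 rho1 rho2; rewrite in_itv /= => /andP[t0 tT].
have lo a b : b <= t -> exists c, forall r, r \in `]a, b[ -> 0 <= a ->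
    indic_vec t u r = c.
  move=> bt; exists (delta_mx 0 u) => r; rewrite in_itv /= => /andP[ar rb] a0.
  rewrite /indic_vec indicE mem_set ?scale1r//= in_itv /=.
  by rewrite (le_trans a0 (ltW ar)) (lt_le_trans rb).
have hi a b : t <= a -> exists c, forall r, r \in `]a, b[ -> 
    indic_vec t u r = c.
  move=> ta; exists 0 => r; rewrite in_itv /= => /andP[ar rb].
  rewrite /indic_vec indicE memNset ?scale0r//= in_itv /= => /andP[_].
  by move=> rt; have := lt_trans rt (le_lt_trans ta ar); rewrite ltxx.
have [tT'|Tt] := ltP t T; last first.
  apply: (Wfun_piecewise_const (s := [:: T])) => //; first exact: itv_partition1.
  by case=> // _; have [c hc] := lo 0 T Tt; exists c => r /hc; exact.
have [t0'|t0'] := ltP 0 t; last first.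
  apply: (Wfun_piecewise_const (s := [:: T])) => //; first exact: itv_partition1.
  by case=> // _; have [c hc] := hi 0 T t0'; exists c => r /hc.
apply: (Wfun_piecewise_const (s := [:: t; T])) => //.
  by split=> //=; rewrite t0' tT'.
case=> [|[|//]] _ /=.
  by have [c hc] := lo 0 t (lexx t); exists c => r /hc; exact.
by have [c hc] := hi t T (lexx t); exists c => r /hc.
Qed.

End Wfunctions.

(** * Limits as the mesh goes to zero *)

Section MeshFilter.
Context {R : realType}.
Implicit Types (T a h : R).

Lemma regular_partition a h n : 0 < h -> exists2 s,
  itv_partition a (a + h *+ n) s &
  forall s1 y s2, s = s1 ++ y :: s2 -> y - last a s1 = h.
Proof.
move=> h0; elim: n a => [|n IHn] a.
  exists [::]; last by case.
  by split; rewrite //= mulr0n addr0.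
have [s [sp sl] hs] := IHn (a + h); exists ((a + h) :: s).
  split=> /=; first by rewrite sp andbT ltrDl.
  by rewrite (eqP sl) mulrS addrA.
case=> [|z s1] y s2 [].
  by move=> <- _ /=; rewrite addrAC subrr add0r.
by move=> <- /hs.
Qed.

Lemma mesh0_filter T : 0 < T -> ProperFilter (mesh0 T).
Proof.
move=> T0; apply: filter_from_proper.
  apply: filter_from_filter; first by exists 1 => /=.
  move=> e e' /= e0 e'0; exists (Num.min e e') => /=; first by rewrite lt_min e0.
  by move=> s /= [sT]; rewrite lt_min => /andP[].
move=> e /= e0; pose n := (Num.truncn (T / e)).+1.
have n0 : 0 < n%:R :> R by rewrite ltr0n.
have [|s sT hs] := @regular_partition 0 (T / n%:R) n.
  by rewrite divr_gt0.
exists s; split; first by rewrite add0r -[_ *+ n]mulr_natr divfK ?gt_eqF in sT.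
apply: mesh_lt => // s1 y s2 es; rewrite (hs _ _ _ es).
rewrite ltr_pdivrMr// mulrC -ltr_pdivrMr//.
by rewrite /n truncnS_gt.
Qed.

Lemma mesh0_near T (P : seq R -> Prop) h : 0 < h ->
  (forall s : seq R, itv_partition 0 T s -> mesh s < h -> P s) ->
  \forall s \near mesh0 T, P s.
Proof. by move=> h0 hP; exists h => //= s [/hP]. Qed.

Lemma mesh0_part T : \forall s \near mesh0 T, itv_partition 0 T s.
Proof. exact: (@mesh0_near _ _ 1). Qed.

Lemma mesh0_cauchy_cvg T (H : completeNormedModType R) (F : seq R -> H) :
  0 < T ->
  (forall e : R, 0 < e -> exists2 h, 0 < h & forall s s' : seq R,
     itv_partition 0 T s -> itv_partition 0 T s' -> mesh s < h -> mesh s' < h ->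
     `|F s - F s'| <= e) ->
  cvg (F @ mesh0 T).
Proof.
move=> T0 hF; have PF := mesh0_filter T0.
apply/cauchy_cvgP; apply: cauchy_exP => e e0.
have e2 : 0 < e / 2 by rewrite divr_gt0.
have [h h0 hh] := hF _ e2.
have [s0 [s0T ms0]] : exists s0, itv_partition 0 T s0 /\ mesh s0 < h.
  by apply: (@filter_ex _ (mesh0 T)); exists h.
exists (F s0); exists h => //= s [sT ms]; rewrite -ball_normE /ball_ /=.
by apply: (le_lt_trans (hh _ _ s0T sT ms0 ms)); lra.
Qed.

End MeshFilter.

Section HeineCantor.
Context {R : realType} (T : R) (N : R -> R -> R).

(** The Heine-Cantor theorem for a pseudo-metric N. *)
Lemma heine_cantor :
  (forall a b, N a b = N b a) -> (forall a b c, N a c <= N a b + N b c) ->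
  (forall t (e : R), 0 <= t <= T -> 0 < e -> exists2 h, 0 < h &
     forall a, 0 <= a <= T -> `|a - t| < h -> N a t <= e) ->
  forall e : R, 0 < e -> exists2 h, 0 < h &
  forall a b, 0 <= a -> a < b -> b <= T -> b - a < h -> N b a <= e.
Proof.
move=> NC ND Nc e e0.
have e2 : 0 < e / 2 by rewrite divr_gt0.
have /compact_near_coveringP/(_ R (0^'+) (fun h a => forall b, a < b -> 0 <= a ->
  b <= T -> b - a < h -> N b a <= e)) := @segment_compact R 0 T.
case.
  move=> t; rewrite /= in_itv /= => tT.
  have [h h0 hh] := Nc t _ tT e2.
  near=> a k => /= b ab a0 bT bak.
  rewrite [e]splitr; apply: (le_trans (ND b t a)); apply: lerD.
    apply: hh; first by rewrite bT (le_trans a0 (ltW ab)).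
    have -> : b - t = (b - a) + (a - t) by rewrite subrKA.
    apply: (le_lt_trans (ler_normD _ _)); rewrite [h]splitr; apply: ltrD.
      rewrite ger0_norm ?subr_ge0 ?(ltW ab)//; apply: (lt_trans bak).
      near: k; apply: nbhs_right_lt; exact: divr_gt0.
    near: a; apply/nbhs_ballP; exists (h / 2) => /=; first exact: divr_gt0.
    by move=> z; rewrite -ball_normE /= distrC.
  rewrite NC; apply: hh; first by rewrite a0 (le_trans (ltW ab)).
  near: a; apply/nbhs_ballP; exists h => //=.
  by move=> z; rewrite -ball_normE /= distrC.
move=> h /= h0 hh.
exists (h / 2); first exact: divr_gt0.
move=> a b a0 ab bT bah.
apply: (hh (h / 2)) => //=.
- by rewrite sub0r normrN gtr0_norm ?divr_gt0//; lra.
- exact: divr_gt0.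
- by rewrite in_itv /= a0 (le_trans (ltW ab)).
Unshelve. all: by end_near. Qed.

End HeineCantor.

(** * The embedding into the Hilbert space *)

Section Embedding.
Context {R : realType} (T : R) (d : nat) (C : R -> R -> R) (rho : R).
Hypotheses (T_gt0 : 0 < T) (d_gt0 : (0 < d)%N).
Hypothesis C_cont :
  {within `[0, T] `*` `[0, T], continuous (fun x => C x.1 x.2)}.
Hypotheses (rho_ge1 : 1 <= rho) (rho_lt2 : rho < 2).
Hypothesis C_var : finite_variation2 T rho C.
Context (H : completeNormedModType R) (ip : {dot H for @idfun R})
  (J : (R -> 'rV[R]_d) -> H).
Hypothesis HJ : is_H1 T C ip J.
Implicit Types (f g : R -> 'rV[R]_d) (s : seq R) (u v : 'I_d).

Let ip_norm : forall x : H, ip x x = `|x| ^+ 2 := ip_norm HJ.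

(** This path stands for the component u of the Gaussian process: its Gram kernel
    is the covariance C. *)
Definition Jpath (u : 'I_d) (t : R) : H := J (indic_vec t u).

Lemma ip_Jpath u v a b : 0 <= a <= T -> 0 <= b <= T ->
  ip (Jpath u a) (Jpath v b) = (u == v)%:R * C a b.
Proof. by move=> aT bT; apply: (J_ip HJ); rewrite in_itv. Qed.

Lemma indic_span_lin c f g : indic_span T f -> indic_span T g ->
  indic_span T (c *: f + g).
Proof.
move=> [n [k [t [u [tT ->]]]]] [m [k' [t' [u' [t'T ->]]]]].
exists (n + m)%N,
  (fun i => match fintype.split i with inl j => c * k j | inr j => k' j end),
  (fun i => match fintype.split i with inl j => t j | inr j => t' j end),
  (fun i => match fintype.split i with inl j => u j | inr j => u' j end).
split; first by move=> i; case: fintype.split.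
rewrite big_split_ord /= scaler_sumr; congr (_ + _); apply: eq_bigr => i _.
  by rewrite (unsplitK (inl i)) scalerA.
by rewrite (unsplitK (inr i)).
Qed.

Lemma indic_span_vec t u : t \in `[0, T] -> indic_span T (indic_vec t u).
Proof.
move=> tT; exists 1%N, (fun=> 1), (fun=> t), (fun=> u); split=> //.
by rewrite big_ord1 scale1r.
Qed.

Lemma indic_span0 : indic_span T (0 : R -> 'rV[R]_d).
Proof.
exists 0%N, (fun=> 0), (fun=> 0), (fun=> Ordinal d_gt0); split; first by case.
by rewrite big_ord0.
Qed.

Lemma J_zero : J 0 = 0.
Proof.
have := J_linear HJ 1 indic_span0 indic_span0.
by rewrite !scale1r addr0 => /esym/eqP; rewrite -subr_eq0 addrK => /eqP.
Qed.

Lemma J_sum I (r : seq I) (F : I -> R -> 'rV[R]_d) (c : I -> R) :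
  (forall i, indic_span T (F i)) ->
  indic_span T (\sum_(i <- r) c i *: F i) /\
  J (\sum_(i <- r) c i *: F i) = \sum_(i <- r) c i *: J (F i).
Proof.
move=> FS; elim: r => [|i r [IH1 IH2]].
  by rewrite !big_nil J_zero; split=> //; exact: indic_span0.
rewrite !big_cons (J_linear HJ)// IH2; split=> //.
exact: indic_span_lin.
Qed.

Lemma indic_vec0 u : indic_vec 0 u = 0 :> (R -> 'rV[R]_d).
Proof.
by apply/funext => r; rewrite /indic_vec set_itvco0 indic0 scale0r.
Qed.

Lemma Jpath0 u : Jpath u 0 = 0. Proof. by rewrite /Jpath indic_vec0 J_zero. Qed.

Lemma part_mem s i : itv_partition 0 T s -> (i < size s)%N ->
  [/\ 0 <= (0 :: s)`_i <= T, 0 <= s`_i <= T & (0 :: s)`_i < s`_i].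
Proof.
move=> sT; move: i; apply/(forall_consecutive
  (fun a b => [/\ 0 <= a <= T, 0 <= b <= T & a < b]) s) => s1 y s2 es.
have [h1 h2 h3] := part_consecutive sT es.
rewrite h1 h3 (le_trans h1 (ltW h2)); split=> //.
by rewrite (le_trans (ltW h2)).
Qed.

Lemma step_span f s : itv_partition 0 T s ->
  indic_span T (step_fun f s) /\ J (step_fun f s) =
  \sum_(u < d) riemann_sum (fun t => f t 0 u) (Jpath u) 0 s.
Proof.
move=> sT.
pose F (iu : 'I_(size s) * 'I_d) : R -> 'rV[R]_d :=
  (-1) *: indic_vec (0 :: s)`_iu.1 iu.2 + indic_vec s`_iu.1 iu.2.
pose c (iu : 'I_(size s) * 'I_d) := f (0 :: s)`_iu.1 0 iu.2.
have FS iu : indic_span T (F iu).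
  have [h1 h2 _] := part_mem sT (ltn_ord iu.1).
  by apply: indic_span_lin; apply: indic_span_vec; rewrite in_itv.
have [] := @J_sum _ (index_enum _) F c FS.
have -> : \sum_iu c iu *: F iu = step_fun f s.
  apply/funext => r; rewrite /step_fun fct_sumE.
  rewrite -(pair_big xpredT xpredT (fun i u => (c (i, u) *: F (i, u)) r)) /=.
  apply: eq_bigr => i _.
  have [/andP[a0 aT] /andP[b0 bT] ab] := part_mem sT (ltn_ord i).
  rewrite [f _ in RHS]row_sum_delta scaler_sumr; apply: eq_bigr => u _.
  rewrite /F /c /= -[LHS]/(f _ 0 u *: ((-1) *: indic_vec _ u r + indic_vec _ u r)).
  rewrite /indic_vec !scalerA -scalerDl scalerA; congr (_ *: _).
  rewrite mulrC; congr (_ * _); rewrite !indicE !mem_setE /= !in_itv /=.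
  case: (ltP r s`_i); case: (leP 0 r); case: (leP (0 :: s)`_i r) => //=; lra.
move=> h ->; split=> //.
rewrite -(pair_big xpredT xpredT (fun i u => c (i, u) *: J (F (i, u)))) /=.
rewrite exchange_big /=; apply: eq_bigr => u _.
rewrite /riemann_sum -csumE; apply: eq_bigr => i _; congr (_ *: _).
have [h1 h2 _] := part_mem sT (ltn_ord i).
rewrite /Jpath /F (J_linear HJ) ?scaleN1r 1?addrC//; apply: indic_span_vec; by rewrite in_itv.
Qed.


(** |x_b - x_t|^2 = C b b - 2 C b t + C t t tends to 0 as b tends to t, by
    continuity of C at the diagonal point (t, t). *)
Lemma Jpath_unif u (e : R) : 0 < e -> exists2 h, 0 < h &
  forall a b, 0 <= a -> a < b -> b <= T -> b - a < h ->
  `|Jpath u b - Jpath u a| <= e.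
Proof.
move: e; apply: (@heine_cantor _ T (fun a b => `|Jpath u a - Jpath u b|)).
- by move=> a b; rewrite distrC.
- by move=> a b c; rewrite -(subrKA (Jpath u b)) ler_normD.
move=> t e tT e0.
have e2 : 0 < e ^+ 2 / 3 by rewrite divr_gt0// exprn_gt0.
have Ktt : (`[0, T] `*` `[0, T]) (t, t) by split; rewrite /= in_itv.
move/subspace_continuousP/(_ _ Ktt)/cvgrPdist_lt/(_ _ e2): C_cont.
move=> [[A B] /= [/nbhs_ballP[h1 /= h10 hA] /nbhs_ballP[h2 /= h20 hB]] sub].
have near a b : 0 <= a <= T -> 0 <= b <= T -> `|a - t| < Num.min h1 h2 ->
    `|b - t| < Num.min h1 h2 -> `|C t t - C a b| < e ^+ 2 / 3.
  move=> aT bT ha hb; apply: (sub (a, b)); last by split; rewrite /= in_itv.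
  split=> /=.
    by apply: hA; rewrite -ball_normE /= distrC (lt_le_trans ha)// ge_min lexx.
  by apply: hB; rewrite -ball_normE /= distrC (lt_le_trans hb)// ge_min lexx orbT.
exists (Num.min h1 h2) => [|a aT ha]; first by rewrite lt_min h10.
have tt : `|t - t| < Num.min h1 h2 by rewrite subrr normr0 lt_min h10.
rewrite -(@ler_pXn2r _ 2) ?nnegrE ?(ltW e0)// -ip_norm.
rewrite linearBl /= !linearBr /= !ip_Jpath// eqxx !mul1r.
have := near a a aT aT ha ha; have := near a t aT tT ha tt.
have := near t a tT aT tt ha; rewrite !ltr_norml.
by move=> /andP[? ?] /andP[? ?] /andP[? ?]; lra.
Qed.

Lemma ip_Jpath_incr u v a b c e : 0 <= a <= T -> 0 <= b <= T -> 0 <= c <= T ->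
  0 <= e <= T -> ip (Jpath u b - Jpath u a) (Jpath v e - Jpath v c) =
  (u == v)%:R * rect_incr C a b c e.
Proof.
move=> *; rewrite linearBl /= !linearBr /= !ip_Jpath// /rect_incr -!mulrBr.
by congr (_ * _); lra.
Qed.

Lemma Jpath_var u : exists2 V, 0 < V & forall s s', itv_partition 0 T s ->
  itv_partition 0 T s' ->
  csum (fun a b => csum (fun c e => `|ip (Jpath u b - Jpath u a) (Jpath u e - Jpath u c)| `^ rho)
    0 s') 0 s <= V.
Proof.
have [V hV] := C_var; exists (`|V| + 1) => [|s s' sT s'T].
  by rewrite ltr_wpDl.
apply: le_trans (_ : V <= _); last by have := ler_norm V; lra.
apply: hV; exists s, s'; split=> //; rewrite -csumE; apply: eq_bigr => i _.
rewrite -csumE; apply: eq_bigr => j _; congr (`|_| `^ _).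
have [h1 h2 _] := part_mem sT (ltn_ord i).
have [h3 h4 _] := part_mem s'T (ltn_ord j).
by rewrite ip_Jpath_incr// eqxx mul1r.
Qed.

#[local] Instance mesh0T_filter : ProperFilter (mesh0 T) := mesh0_filter T_gt0.

(** The coordinates of f are treated separately, by [gram_cauchy]. *)
Lemma step_cvg f : Wfun T rho f -> cvg ((fun s => J (step_fun f s)) @ mesh0 T).
Proof.
move=> Wf.
have hu u : cvg ((fun s => riemann_sum (fun t => f t 0 u) (Jpath u) 0 s) @ mesh0 T).
  apply: mesh0_cauchy_cvg => // e e0.
  have [p [p1 young [A A0 hA]]] := Wfun_young u T_gt0 rho_ge1 Wf.
  have [V V0 hV] := Jpath_var u.
  have A1 : 0 < A + 1 by rewrite ltr_wpDl.
  apply: (gram_cauchy ip_norm T_gt0 p1 rho_ge1 A1 V0 young _ hV (@Jpath_unif u)) => //.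
  move=> s sT; apply: le_trans (_ : A <= _); last by lra.
  have [sp /eqP sl] := sT; apply: hA => // y; rewrite inE /= in_itv /=.
  move=> /orP[/eqP ->|ys]; first by rewrite lexx ltW.
  rewrite -sl part_le_last// andbT.
  by move: sp; rewrite lt_path_sortedE => /andP[/allP h _]; exact/ltW/h.
have : (fun s => \sum_(u < d) riemann_sum (fun t => f t 0 u) (Jpath u) 0 s)
    @ mesh0 T --> \sum_(u < d)
    lim ((fun s => riemann_sum (fun t => f t 0 u) (Jpath u) 0 s) @ mesh0 T).
  apply: cvg_big; first exact: add_continuous.
  by move=> u _; exact: hu.
move=> h; apply: (cvgP _ (cvg_trans _ h)); apply: near_eq_cvg.
near=> s.
have sT : itv_partition 0 T s by near: s; exact: mesh0_part.
by have [_ ->] := step_span f sT.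
Unshelve. all: by end_near. Qed.

Definition embed f : H := lim ((fun s => J (step_fun f s)) @ mesh0 T).

Lemma embed_cvg f : Wfun T rho f ->
  (fun s => J (step_fun f s)) @ mesh0 T --> embed f.
Proof. exact: step_cvg. Qed.

Lemma embed_unique f l : (fun s => J (step_fun f s)) @ mesh0 T --> l ->
  embed f = l.
Proof. by apply: cvg_lim; exact: norm_hausdorff. Qed.

Lemma embed_lin c f g : Wfun T rho f -> Wfun T rho g ->
  embed (c *: f + g) = c *: embed f + embed g.
Proof.
move=> Wf Wg; apply: embed_unique.
have : (fun s => c *: J (step_fun f s) + J (step_fun g s)) @ mesh0 T -->
    c *: embed f + embed g.
  by apply: cvgD; [apply: cvgZl_tmp|]; exact: embed_cvg.
apply: cvg_trans; apply: near_eq_cvg.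
near=> s.
have sT : itv_partition 0 T s by near: s; exact: mesh0_part.
rewrite -(J_linear HJ); [|by have [] := step_span f sT|by have [] := step_span g sT].
congr (J _); apply/esym/funext => r.
rewrite -[RHS]/(c *: step_fun f s r + step_fun g s r) /step_fun.
rewrite scaler_sumr -big_split /=; apply: eq_bigr => i _.
by rewrite -[(_ + _) _]/(c *: f _ + g _) scalerDr !scalerA mulrC.
Unshelve. all: by end_near. Qed.

(** Off-diagonal pairs of coordinates vanish by orthogonality, and the products
    <x_b - x_a, x_e - x_c> are the rectangular increments of C. *)
Lemma young_sum_ip f g s s' : itv_partition 0 T s -> itv_partition 0 T s' ->
  young_sum (W_integrand f g) C (s, s') =
  ip (J (step_fun f s)) (J (step_fun g s')).
Proof.
move=> sT s'T.
have -> : J (step_fun f s) = \sum_(i < size s) \sum_(u < d)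
    f (0 :: s)`_i 0 u *: (Jpath u s`_i - Jpath u (0 :: s)`_i).
  have [_ ->] := step_span f sT; rewrite exchange_big; apply: eq_bigr => u _.
  by rewrite /riemann_sum -csumE.
have -> : J (step_fun g s') = \sum_(j < size s') \sum_(v < d)
    g (0 :: s')`_j 0 v *: (Jpath v s'`_j - Jpath v (0 :: s')`_j).
  have [_ ->] := step_span g s'T; rewrite exchange_big; apply: eq_bigr => u _.
  by rewrite /riemann_sum -csumE.
rewrite [RHS]linear_sumlz; apply: eq_bigr => i _.
rewrite [RHS]linear_sumr; apply: eq_bigr => j _ /=.
have [h1 h2 _] := part_mem sT (ltn_ord i).
have [h3 h4 _] := part_mem s'T (ltn_ord j).
rewrite /W_integrand /dotv mulr_suml [RHS]linear_sumlz /=; apply: eq_bigr => u _.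
rewrite [RHS]linear_sumr (bigD1 u) //= big1 ?addr0 => [|v vu].
  by rewrite [RHS]linearZl_LR /= linearZr_LR /= ip_Jpath_incr// eqxx mul1r mulrA.
by rewrite [LHS]linearZl_LR /= linearZr_LR /= ip_Jpath_incr// eq_sym (negbTE vu) mul0r !mulr0.
Qed.

(** Polarisation reduces the continuity of the inner product to that of the
    norm. *)
Lemma ip_polar (y z : H) :
  ip y z = 2^-1 * (`|y + z| * `|y + z| - `|y| * `|y| - `|z| * `|z|).
Proof.
rewrite -!expr2 -!ip_norm linearDl /= !linearDr /= (ipC ip z y).
lra.
Qed.

Lemma young_cvg f g : Wfun T rho f -> Wfun T rho g ->
  young_sum (W_integrand f g) C @ filter_prod (mesh0 T) (mesh0 T) -->
  ip (embed f) (embed g).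
Proof.
move=> Wf Wg.
have cf : (fun pi : seq R * seq R => J (step_fun f pi.1)) @
    filter_prod (mesh0 T) (mesh0 T) --> embed f.
  by apply: cvg_comp (embed_cvg Wf); exact: cvg_fst.
have cg : (fun pi : seq R * seq R => J (step_fun g pi.2)) @
    filter_prod (mesh0 T) (mesh0 T) --> embed g.
  by apply: cvg_comp (embed_cvg Wg); exact: cvg_snd.
have : (fun pi : seq R * seq R => ip (J (step_fun f pi.1)) (J (step_fun g pi.2)))
    @ filter_prod (mesh0 T) (mesh0 T) --> ip (embed f) (embed g).
  under eq_fun do rewrite ip_polar.
  rewrite ip_polar; apply: cvgMl_tmp; apply: cvgB; first apply: cvgB.
  - by apply: cvgM; apply: cvg_norm; exact: cvgD.
  - by apply: cvgM; exact: cvg_norm.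
  - by apply: cvgM; exact: cvg_norm.
apply: cvg_trans; apply: near_eq_cvg.
exists (itv_partition 0 T, itv_partition 0 T).
  by split; exact: mesh0_part.
by move=> [s s'] [/= sT s'T]; rewrite young_sum_ip.
Qed.


Lemma embed0 : embed 0 = 0.
Proof.
have W0 := @Wfun0 _ d _ _ T_gt0 rho_ge1 rho_lt2.
have := embed_lin (-1) W0 W0.
by rewrite scaler0 addr0 scaleN1r addNr.
Qed.

Lemma embedB f g : Wfun T rho f -> Wfun T rho g ->
  embed (f - g) = embed f - embed g.
Proof. by move=> Wf Wg; rewrite addrC -scaleN1r embed_lin// scaleN1r addrC. Qed.

(** The sum telescopes up to y, the first point of the partition not before t. *)
Lemma riemann_sum_indic (V : lmodType R) (G : R -> V) t a s :
  0 <= a -> a < t -> t <= last a s -> path <%R a s ->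
  exists s1 y s2, [/\ s = s1 ++ y :: s2, last a s1 < t, t <= y &
    riemann_sum (\1_(`[0, t[ : set R)) G a s = G y - G a].
Proof.
have out b r : t <= b -> path <%R b r ->
    riemann_sum (\1_(`[0, t[ : set R)) G b r = 0.
  elim: r b => //= c r IHr b tb /andP[bc cr].
  rewrite /riemann_sum /= -/(riemann_sum _ _ _ _) (IHr c)//; last first.
    exact: le_trans (ltW bc).
  by rewrite addr0 indicE memNset ?scale0r//= in_itv /= => /andP[_]; lra.
elim: s a => [|y s IHs] a a0 at_ /=; first by move=> h; lra.
move=> tl /andP[ay ys]; rewrite /riemann_sum /= -/(riemann_sum _ _ _ _).
rewrite indicE mem_set ?scale1r/= ?in_itv/= ?a0//.
have [ty|yt] := leP t y.
  by exists [::], y, s; rewrite out// addr0.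
have [s1 [z [s2 [-> h1 h2 ->]]]] := IHs y (le_trans a0 (ltW ay)) yt tl ys.
by exists (y :: s1), z, s2; split=> //; rewrite addrC subrKA.
Qed.

(** The Riemann sum differs from x_t by x_y - x_t, where y is the first partition
    point not before t, so y - t is smaller than the mesh. *)
Lemma embed_indic t u : t \in `[0, T] -> embed (indic_vec t u) = Jpath u t.
Proof.
move=> tT; have := tT; rewrite in_itv /= => /andP[t0 tT'].
have [->|tn0] := eqVneq t 0; first by rewrite indic_vec0 embed0 Jpath0.
have {tn0} t_gt0 : 0 < t by rewrite lt_neqAle eq_sym tn0.
apply: embed_unique; apply/cvgrPdist_le => e e0.
have [h h0 hh] := Jpath_unif u e0.
apply: (mesh0_near h0) => s sT ms.
have [_ ->] := step_span (indic_vec t u) sT.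
rewrite (bigD1 u) //= big1 ?addr0 => [|v vu]; last first.
  rewrite /riemann_sum (@eq_csum _ _ _ (fun _ _ => 0)).
    have csum0 (r : seq R) a : csum (fun _ _ => 0 : H) a r = 0.
      by elim: r a => //= y r IHr a; rewrite add0r.
    exact: csum0.
  move=> s1 y s2 _; rewrite /indic_vec !mxE eqxx (negbTE vu).
  by rewrite mulr0 scale0r.
have -> : (fun r => indic_vec t u r 0 u) = \1_(`[0, t[ : set R).
  by apply/funext => r; rewrite /indic_vec !mxE !eqxx mulr1.
have [sp /eqP sl] := sT.
have [|s1 [y [s2 [es h1 h2 ->]]]] :=
  @riemann_sum_indic _ (Jpath u) t 0 s (lexx 0) t_gt0 _ sp; first by rewrite sl.
rewrite Jpath0 subr0.
have [p1 p2 p3] := part_consecutive sT es.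
have [->|ty] := eqVneq t y; first by rewrite subrr normr0 ltW.
rewrite distrC; apply: hh => //; first by rewrite lt_neqAle ty.
apply: le_lt_trans ms; apply: (le_trans _ (_ : y - last 0 s1 <= _)).
  by rewrite lerD2l lerN2 ltW.
by rewrite es le_mesh.
Qed.

Lemma embed_span f : indic_span T f -> Wfun T rho f /\ embed f = J f.
Proof.
move=> [n [c [t [u [tT ->]]]]].
have [_ ->] := J_sum (index_enum _) c (fun i => indic_span_vec (u i) (tT i)).
elim: (index_enum _) => [|i r [IH1 IH2]].
  by rewrite !big_nil embed0; split=> //; exact: Wfun0.
have Wi := Wfun_indic (u i) T_gt0 rho_ge1 rho_lt2 (tT i).
rewrite !big_cons; split; first exact: Wfun_lin.
by rewrite embed_lin// IH2 embed_indic.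
Qed.

Lemma W_ip_embed f g : Wfun T rho f -> Wfun T rho g ->
  W_ip T C f g = ip (embed f) (embed g).
Proof. by move=> Wf Wg; apply: cvg_lim; [exact: Rhausdorff|exact: young_cvg]. Qed.

(** The identification made in the quotient is equality of the limits, as
    <f - g, f - g> = |embed f - embed g|^2. *)
Lemma W_ip_eq0 f g : Wfun T rho f -> Wfun T rho g ->
  W_ip T C (f - g) (f - g) = 0 <-> embed f = embed g.
Proof.
move=> Wf Wg; have Wfg : Wfun T rho (f - g).
  by rewrite addrC -scaleN1r; exact: Wfun_lin.
rewrite W_ip_embed// embedB// ip_norm; split=> [/eqP|->].
  by rewrite expf_eq0 /= normr_eq0 subr_eq0 => /eqP.
by rewrite subrr normr0 expr0n.
Qed.

Lemma W_class_eq f g : Wfun T rho f -> Wfun T rho g ->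
  W_class T rho C f = W_class T rho C g <-> embed f = embed g.
Proof.
move=> Wf Wg; split=> [e|e].
  have : W_class T rho C f f by split=> //; apply/W_ip_eq0.
  by rewrite e => -[_ /(W_ip_eq0 Wg Wf)].
apply/seteqP; split=> h [Wh] /W_ip_eq0 eh; split=> //; apply/W_ip_eq0 => //.
  by rewrite -e eh.
by rewrite e eh.
Qed.

Lemma W_pi_eq f g (Wf : Wfun T rho f) (Wg : Wfun T rho g) :
  embed f = embed g -> W_pi C Wf = W_pi C Wg.
Proof.
move=> /(W_class_eq Wf Wg) e; rewrite /W_pi.
move: (ex_intro2 _ _ f _ _) (ex_intro2 _ _ g _ _); rewrite e => p q.
by rewrite (Prop_irrelevance p q).
Qed.

(** The limit for an arbitrary representative of the class. *)
Definition Wspace_embed (A : Wspace d T rho C) : H :=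
  embed (s2val (cid2 (proj2_sig A))).

Lemma Wspace_embed_pi f (Wf : Wfun T rho f) :
  Wspace_embed (W_pi C Wf) = embed f.
Proof.
rewrite /Wspace_embed; case: cid2 => g /= Wg e.
by apply/esym/(W_class_eq Wf Wg).
Qed.

End Embedding.

(** * The isometry *)

Theorem proposition4p2
  (R : realType) (T : R) (T_gt0 : 0 < T) (d : nat) (d_gt0 : (0 < d)%N)
  (disp : measure_display) (Omega : measurableType disp)
  (P : probability Omega R) (X : R -> 'I_d -> {RV P >-> R})
  (X_gauss : gaussian_process T X) (X_centered : centered_process T X)
  (X_cont : continuous_process T X) (X_indep : independent_components T X)
  (X_ident : identical_components T X) (X_start : starts_at_origin X)
  (C : R -> R -> R) (CE : C = covariance_fun X (Ordinal d_gt0))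
  (C_cont : {within `[0, T] `*` `[0, T], continuous (fun x => C x.1 x.2)})
  (rho : R) (rho_ge1 : 1 <= rho) (rho_lt2 : rho < 2)
  (C_var : finite_variation2 T rho C)
  (H : completeNormedModType R) (ip : {dot H for @idfun R})
  (J : (R -> 'rV[R]_d) -> H) (HJ : is_H1 T C ip J) :
  [/\ Wfun T rho (0 : R -> 'rV[R]_d),
      forall (a : R) (f g : R -> 'rV[R]_d),
        Wfun T rho f -> Wfun T rho g -> Wfun T rho (a *: f + g),
      forall f g : R -> 'rV[R]_d, Wfun T rho f -> Wfun T rho g ->
        young_integrable T (W_integrand f g) C
    & exists i : Wspace d T rho C -> H,
      [/\ forall (f : R -> 'rV[R]_d) (Wf : Wfun T rho f),
            (fun s => J (step_fun f s)) @ mesh0 T --> i (W_pi C Wf),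
          forall (a : R) (f g : R -> 'rV[R]_d) (Wf : Wfun T rho f)
              (Wg : Wfun T rho g) (Wh : Wfun T rho (a *: f + g)),
            i (W_pi C Wh) = a *: i (W_pi C Wf) + i (W_pi C Wg),
          injective i,
          forall (f g : R -> 'rV[R]_d) (Wf : Wfun T rho f)
              (Wg : Wfun T rho g),
            ip (i (W_pi C Wf)) (i (W_pi C Wg)) = W_ip T C f g
        & dense (range i)]].
Proof.
split; first exact: Wfun0.
- by move=> a f g; exact: Wfun_lin.
- move=> f g Wf Wg; apply: cvgP.
  exact: (young_cvg T_gt0 d_gt0 C_cont rho_ge1 C_var HJ Wf Wg).
pose pi_embed := Wspace_embed_pi T_gt0 d_gt0 C_cont rho_ge1 C_var HJ.
exists (@Wspace_embed R T d C rho H J); split.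
- move=> f Wf; rewrite pi_embed.
  exact: (embed_cvg T_gt0 d_gt0 C_cont rho_ge1 C_var HJ Wf).
- move=> a f g Wf Wg Wh; rewrite !pi_embed.
  exact: (embed_lin T_gt0 d_gt0 C_cont rho_ge1 C_var HJ a Wf Wg).
- move=> [A [f Wf eA]] [B [g Wg eB]]; subst A B.
  rewrite -/(W_pi C Wf) -/(W_pi C Wg) !pi_embed.
  exact: (W_pi_eq T_gt0 d_gt0 C_cont rho_ge1 C_var HJ Wf Wg).
- move=> f g Wf Wg; rewrite !pi_embed; apply/esym.
  exact: (W_ip_embed T_gt0 d_gt0 C_cont rho_ge1 C_var HJ Wf Wg).
- move=> O O0 oO; have [y [Oy [f fS fy]]] := J_dense HJ O0 oO.
  have [Wf ef] := embed_span T_gt0 d_gt0 C_cont rho_ge1 rho_lt2 C_var HJ fS.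
  exists y; split=> //; exists (W_pi C Wf) => //.
  by rewrite pi_embed ef.
Qed.
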